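(* Let $k\ge2$, $0\le\alpha<1$, and let $G$ be a $k$-uniform hypertree with $m$ edges and diameter $d\ge2$. Then $\rho_\alpha(G)\le\rho_\alpha(S_{m,d,k})$, with equality if and only if $G\cong S_{m,d,k}$.
   Context: Hypergraphs are finite with edges being sets; $k$-uniform means every edge has $k$ vertices. $\mathcal A_\alpha(G)=\alpha\mathcal D(G)+(1-\alpha)\mathcal A(G)$, where $\mathcal A(G)$ is the order-$k$ tensor with $(i_1,\dots,i_k)$-entry $\frac1{(k-1)!}$ if $\{i_1,\dots,i_k\}\in E(G)$ and $0$ otherwise, and $\mathcal D(G)$ is the diagonal tensor of degrees; for an order-$k$ tensor $\mathcal T$, $(\mathcal Tx)_i=\sum_{i_2,\dots,i_k}\mathcal T_{ii_2\dots i_k}x_{i_2}\cdots x_{i_k}$ and $\lambda$ is an eigenvalue if $\mathcal Tx=\lambda x^{[k-1]}$ for some $x\ne0$; $\rho_\alpha(G)$ is the largest modulus of an eigenvalue of $\mathcal A_\alpha(G)$. A path is an alternating sequence $(v_0,e_1,v_1,\dots,e_s,v_s)$ of distinct vertices and distinct edges with $v_{i-1},v_i\in e_i$, of length $s$; a cycle is such a sequence with at least two edges, distinct edges, and distinct vertices except $v_0=v_s$. A hypertree is a connected hypergraph with no cycles. The distance between two vertices is the length of a shortest path joining them; the diameter is the maximum distance. The $k$-uniform loose path $P_{d,k}=(v_0,e_1,v_1,\dots,e_d,v_d)$ is the $k$-uniform hypertree with $d$ edges in which $v_1,\dots,v_{d-1}$ have degree $2$ and all other vertices have degree $1$. For $2\le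 d\le m$, $S_{m,d,k}$ is the hypertree obtained from $P_{d,k}$ by attaching $m-d$ pendant edges at $v_{\lfloor d/2\rfloor}$, i.e., adding $m-d$ new edges each consisting of $v_{\lfloor d/2\rfloor}$ and $k-1$ new vertices (all new vertices distinct). *)

(* Defs.v *)
From HB Require Import structures.
From mathcomp Require Import all_boot all_order all_algebra.
Set Implicit Arguments. Unset Strict Implicit. Unset Printing Implicit Defensive.
Import Order.TTheory GRing.Theory Num.Theory.

Section Hyper.
Variable V : finType.
Variable E : {set {set V}}.

Definition uniform (k : nat) : Prop := forall e, e \in E -> #|e| = k.

Definition degree (v : V) : nat := #|[set e in E | v \in e]|.

(* A path (v0, e1, v1, ..., es, vs) is encoded by v0 and the list of steps
   [:: (e1,v1); ...; (es,vs)].  [incid u st]: consecutive vertices lie in the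
   corresponding edge, and the edges are edges of E. *)
Fixpoint incid (u : V) (st : seq ({set V} * V)) : bool :=
  match st with
  | [::] => true
  | (e, v) :: st' => [&& e \in E, u \in e, v \in e & incid v st']
  end.

Definition is_path (v0 : V) (st : seq ({set V} * V)) : bool :=
  [&& incid v0 st, uniq (v0 :: map snd st) & uniq (map fst st)].

Definition is_cycle (v0 : V) (st : seq ({set V} * V)) : bool :=
  [&& (2 <= size st)%N, incid v0 st, uniq (map fst st), uniq (map snd st)
    & last v0 (map snd st) == v0].

Definition path_between (u v : V) (n : nat) : Prop :=
  exists st, [&& is_path u st, last u (map snd st) == v & size st == n].

Definition connected : Prop := forall u v : V, exists n, path_between u v n.

Definition hypertree : Prop :=
  connected /\ forall v0 st, ~~ is_cycle v0 st.

Definition diameter_eq (d : nat) : Prop :=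
  (exists u v, path_between u v d /\ forall n, (n < d)%N -> ~ path_between u v n)
  /\ forall u v, exists n, (n <= d)%N /\ path_between u v n.

End Hyper.

Definition hiso (V1 V2 : finType) (E1 : {set {set V1}}) (E2 : {set {set V2}}) : Prop :=
  exists f : V1 -> V2, bijective f /\ forall e : {set V1}, (e \in E1) = (f @: e \in E2).

(* Order-k tensors over V with entries in C: T s is the entry indexed by the
   list s = [:: i1; ...; ik]. *)
Section Tensor.
Variable C : numClosedFieldType.
Variable V : finType.
Local Open Scope ring_scope.

Definition tapp (k : nat) (T : seq V -> C) (x : V -> C) (i : V) : C :=
  \sum_(t : (k.-1).-tuple V) T (i :: t) * \prod_(j <- t) x j.

Definition is_eigenvalue (k : nat) (T : seq V -> C) (l : C) : Prop :=
  exists x : V -> C, (exists i, x i != 0) /\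
    forall i, tapp k T x i = l * x i ^+ k.-1.

Definition is_spectral_radius (k : nat) (T : seq V -> C) (r : C) : Prop :=
  (exists l, is_eigenvalue k T l /\ `|l| = r) /\
  forall l, is_eigenvalue k T l -> `|l| <= r.

Variable E : {set {set V}}.

Definition adjT (k : nat) (s : seq V) : C :=
  if [set x in s] \in E then ((k.-1)`!)%:R^-1 else 0.

Definition degT (s : seq V) : C :=
  match s with
  | i :: rest => if all (fun j => j == i) rest then (degree E i)%:R else 0
  | [::] => 0
  end.

Definition AalphaT (k : nat) (alpha : C) (s : seq V) : C :=
  alpha * degT s + (1 - alpha) * adjT k s.

End Tensor.

(* The hypertree S_{m,d,k}: vertices 0..m(k-1); for j < m, edge j consists of
   the "root" r_j and the vertices j(k-1)+1, ..., (j+1)(k-1), where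
   r_j = j(k-1) for j < d (so edges 0..d-1 form the loose path P_{d,k} with
   v_j = j(k-1)), and r_j = floor(d/2)(k-1) for d <= j < m (pendant edges
   attached at v_{floor(d/2)}). *)
Definition SV (m k : nat) : finType := 'I_(m * k.-1).+1.

Definition Sroot (d k j : nat) : nat := if (j < d)%N then j * k.-1 else (d./2) * k.-1.

Definition Sedge (m d k j : nat) : {set SV m k} :=
  [set v : SV m k | (nat_of_ord v == Sroot d k j)
                    || ((j * k.-1 < v)%N && (v <= j.+1 * k.-1)%N)].

Definition SE (m d k : nat) : {set {set SV m k}} :=
  [set Sedge m d k (nat_of_ord j) | j : 'I_m].

(* Main.v *)
Require Import Defs.
From HB Require Import structures.
From mathcomp Require Import all_boot all_order all_algebra.
From mathcomp Require Import ring lra zify.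
Set Implicit Arguments. Unset Strict Implicit. Unset Printing Implicit Defensive.
Import Order.TTheory GRing.Theory Num.Theory.

(** Let [B(v,e) > 0] be weights on the incident pairs with
    [\sum_(e \ni v) (alpha + (1 - alpha) B(v,e)) = lam] at every vertex.  If
    [\prod_(v in e) B(v,e) >= 1] for every edge, AM-GM bounds the modulus of every
    eigenvalue by [lam], and on a connected hypergraph equality forces all the products to
    be 1; conversely, weights with all products 1 on a tree come from a positive eigenvector.

    On S_{m,d,k} the product conditions determine the loads [alpha + (1 - alpha) B] along the
    path: at distance [j] from an end they are [w_0 = 0],
    [w_(j+1) = alpha + (1 - alpha)^k / (L^(k-2) (L - w_j))] where [lam = L + alpha], and the
    condition at the centre reads [lam = w_s + w_t + (m - d) w_1] with [s = d/2] rounded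
    down and [t = d - s].  The intermediate value theorem for rational functions over the
    real part of [C] provides a solution [lam], which is then an eigenvalue.

    In a hypertree [G] containing a path v_0, ..., v_d (all that is used of the diameter),
    root [G] at v_s and give the root of an edge [e] the load [w_h + x w_1], where [h] and [x]
    count the edges on and off the path that lie in the branch of [e]; the other vertices of
    [e] get what is missing to reach [lam].  The product condition follows from the equation
    at the centre, and it is tight everywhere only if all edges off the path contain v_s, or
    all of them contain v_t with [t = s + 1]; both say that [G] is isomorphic to
    S_{m,d,k}. *)

(** * Walks and rooted hypertrees *)

Section Walks.
Variable V : finType.
Implicit Types (F : {set {set V}}) (st : seq ({set V} * V)).

(** Walks drop the distinctness conditions of paths, so that they concatenate freely; [walk_path]
    recovers a path. *)
Definition walk F (x y : V) :=
  exists2 st, incid F x st & last x (map snd st) = y.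

Lemma walk_refl F x : walk F x x. Proof. by exists [::]. Qed.

Lemma walk_step F e x y z : e \in F -> x \in e -> y \in e -> walk F y z -> walk F x z.
Proof.
by move=> eF xe ye [st inc l]; exists ((e, y) :: st) => //=; rewrite eF xe ye.
Qed.

Lemma walk_trans F x y z : walk F x y -> walk F y z -> walk F x z.
Proof.
case=> st; elim: st x => [|[e v] st IHst] x /= => [_ ->//|/and4P[eF xe ve inc] l] yz.
by apply: (walk_step eF xe ve); apply: IHst.
Qed.

Lemma walk_sub F F' x y : F \subset F' -> walk F x y -> walk F' x y.
Proof.
move=> /subsetP FF' [st]; elim: st x => [|[e v] st IHst] x /=.
  by move=> _ ->; exact: walk_refl.
move=> /and4P[eF xe ve inc] l.
by apply: (walk_step (FF' e eF) xe ve); apply: IHst.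
Qed.

Lemma is_path_tail F x e v st : is_path F x ((e, v) :: st) -> is_path F v st.
Proof.
by case/and3P=> /= /and4P[_ _ _ inc] /andP[_ uv] /andP[_ ue]; apply/and3P.
Qed.

Lemma is_path_cut F x st u : is_path F x st -> u \in x :: map snd st ->
  exists2 st', is_path F u st' & last u (map snd st') = last x (map snd st).
Proof.
elim: st x => [|[e v] st IHst] x pst; first by rewrite inE => /eqP->; exists [::].
rewrite in_cons => /predU1P[->|ust]; first by exists ((e, v) :: st).
exact: IHst (is_path_tail pst) ust.
Qed.

Lemma is_path_reenter F x st u e : is_path F x st -> e \in map fst st ->
  u \in e -> u \notin x :: map snd st ->
  exists2 st', is_path F u st' & last u (map snd st') = last x (map snd st).
Proof.
elim: st x => [|[f v] st IHst] x pst //=.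
rewrite in_cons => /predU1P[ef|est] ue ux; last first.
  by apply: (IHst v (is_path_tail pst) est ue); move: ux; rewrite in_cons negb_or => /andP[].
exists ((f, v) :: st) => //; case/and3P: pst => /= /and4P[fF xf vf inc] /andP[_ uv] uf.
rewrite ef in ue; rewrite /is_path /= fF ue vf inc uf uv !andbT.
by move: ux; rewrite in_cons negb_or => /andP[].
Qed.

(** Prepending the step through [e] fails only if [u] or [e] already occurs. Then a final segment
    suffices: the one starting at [u], or the one starting with the step through [e], whose first
    vertex may be replaced by [u]. *)
Lemma is_path_extend F x st u e : e \in F -> u \in e -> x \in e -> is_path F x st ->
  exists2 st', is_path F u st' & last u (map snd st') = last x (map snd st).
Proof.
move=> eF ue xe pst.
have [ust|ust] := boolP (u \in x :: map snd st); first exact: is_path_cut ust.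
have [est|est] := boolP (e \in map fst st); first exact: is_path_reenter pst est ue ust.
exists ((e, x) :: st) => //; case/and3P: pst => inc uv ue'.
by apply/and3P; split=> /=; [rewrite eF ue xe|rewrite ust|rewrite est].
Qed.

Lemma walk_path F x y : walk F x y ->
  exists2 st, is_path F x st & last x (map snd st) = y.
Proof.
case=> st; elim: st x => [|[e v] st IHst] x /=; first by exists [::].
move=> /and4P[eF xe ve inc] l; have [st' pst' l'] := IHst v inc l.
by have [st'' p l''] := is_path_extend eF xe ve pst'; exists st''; rewrite ?l''.
Qed.

Lemma incid_rcons F x st e y : incid F x (rcons st (e, y)) =
  [&& incid F x st, e \in F, last x (map snd st) \in e & y \in e].
Proof.
elim: st x => [|[f v] st IHst] x /=; first by rewrite andbT.
by rewrite IHst !andbA.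
Qed.

Lemma incid_sub F F' x st : F \subset F' -> incid F x st -> incid F' x st.
Proof.
move=> /subsetP FF'; elim: st x => [|[e v] st IHst] x //= /and4P[eF -> -> inc].
by rewrite FF'// IHst.
Qed.

(** If [x] and [y] were distinct, a path in [F] between them, which avoids [e], would be closed by
    [e] into a cycle. *)
Lemma walk_edge_eq (E F : {set {set V}}) x y e : (forall v0 st, ~~ is_cycle E v0 st) ->
  F \subset E -> e \in E -> e \notin F -> x \in e -> y \in e -> walk F x y -> x = y.
Proof.
move=> acyc FE eE eF xe ye /walk_path[st /and3P[inc uv ue] l].
have est : e \notin map fst st.
  apply: contra eF; elim: st x inc {xe uv ue l} => [|[f v] st IHst] x //=.
  by move=> /and4P[fF _ _ inc]; rewrite in_cons => /predU1P[->//|]; apply: IHst inc.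
case: st inc uv ue l est => [|[f v] st] inc uv ue l est //.
have /negP[] := acyc x (rcons ((f, v) :: st) (e, x)).
rewrite /is_cycle incid_rcons (incid_sub FE inc) eE l ye xe size_rcons.
move: ue uv est; rewrite !map_rcons !rcons_uniq last_rcons.
by move=> -> /= /andP[-> ->] ->; rewrite eqxx.
Qed.

End Walks.

Section Rooting.
Variables (V : finType) (E : {set {set V}}).
Hypothesis acyclic : forall v0 st, ~~ is_cycle E v0 st.

(** An orientation away from [c] of the part with edges [F] and vertices [U]: [r e] is the vertex of
    [e] on the side of [c], and [p u] is the edge leading from [u] towards [c]. The rank [rk] grows
    away from [c] and supports recursion on the tree. *)
Record rooted (F : {set {set V}}) (U : {set V}) (c : V)
  (r : {set V} -> V) (p : V -> {set V}) (rk : V -> nat) : Prop := Rooted {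
  rooted_edges : F \subset E;
  rooted_center : c \in U;
  rooted_cover : forall e, e \in F -> e \subset U;
  rooted_root : forall e, e \in F -> r e \in e;
  rooted_parent : forall u, u \in U -> u != c -> [/\ p u \in F, u \in p u & u != r (p u)];
  rooted_child : forall e u, e \in F -> u \in e -> u != r e -> u != c /\ p u = e;
  rooted_rank : forall e u, e \in F -> u \in e -> u != r e -> (rk (r e) < rk u)%N;
  rooted_walk : forall x y, x \in U -> y \in U -> walk F x y }.

(** By acyclicity [e] meets [U] in [u] alone, since any two vertices of [U] are joined by a walk in
    [F]. The other vertices of [e] are therefore new and become its children. *)
Lemma rooted_extend F U c r p rk e u : rooted F U c r p rk ->
  e \in E -> e \notin F -> u \in e -> u \in U ->
  exists r' p' rk', [/\ rooted (e |: F) (U :|: e) c r' p' rk', r' e = u &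
    forall f, f \in F -> r' f = r f].
Proof.
move=> [FE cU cov root par child rank wk] eE eF ue uU.
have eU v : v \in e -> v \in U -> v = u.
  by move=> ve vU; apply: (walk_edge_eq acyclic FE eE eF ve ue); apply: wk.
exists (fun f => if f == e then u else r f), (fun v => if v \in U then p v else e),
  (fun v => if v \in U then rk v else (rk u).+1).
have Fe f : f \in F -> (f == e) = false.
  by move=> fF; apply: contraNF eF => /eqP <-.
split; [split|by rewrite eqxx|by move=> f /Fe ->].
- by rewrite subUset sub1set eE.
- by rewrite inE cU.
- move=> f; rewrite !inE => /predU1P[->|fF]; first exact: subsetUr.
  by apply: subset_trans (cov f fF) (subsetUl _ _).
- by move=> f; rewrite !inE => /predU1P[->|fF]; rewrite ?eqxx// Fe// root.
- move=> v; rewrite !inE; have [vU _ vc|vU /= ve _] := boolP (v \in U).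
    by have [pF vp vr] := par v vU vc; rewrite Fe// pF orbT.
  by rewrite eqxx; split=> //; apply: contraNneq vU => ->.
- move=> f v; rewrite !inE => /predU1P[->|fF].
    rewrite eqxx => ve vu; have vU : v \notin U by apply: contra vu => /(eU v ve)->.
    by rewrite (negPf vU); split=> //; apply: contraNneq vU => ->.
  rewrite Fe// => vf vr; have vU : v \in U := subsetP (cov f fF) v vf.
  by rewrite vU; apply: child.
- move=> f v; rewrite !inE => /predU1P[->|fF].
    rewrite eqxx uU => ve vu; have vU : v \notin U by apply: contra vu => /(eU v ve)->.
    by rewrite (negPf vU).
  rewrite Fe// => vf vr; have fU := subsetP (cov f fF).
  by rewrite !fU ?root//; apply: rank.
have wF x y : walk F x y -> walk (e |: F) x y by apply: walk_sub; apply: subsetUr.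
have ee : e \in e |: F by rewrite !inE eqxx.
have wu x : x \in U :|: e -> walk (e |: F) x u /\ walk (e |: F) u x.
  rewrite inE => /orP[xU|xe]; first by split; apply: wF; apply: wk.
  by split; [apply: (walk_step ee xe ue)|apply: (walk_step ee ue xe)]; exact: walk_refl.
by move=> x y /wu[xu _] /wu[_ uy]; apply: walk_trans uy.
Qed.

Lemma rooted_sequence c n (ee : nat -> {set V}) (uu : nat -> V) :
  (forall i, (i < n)%N -> ee i \in E /\ uu i \in ee i) ->
  (forall i j, (i < j < n)%N -> ee i != ee j) ->
  (forall i, (i < n)%N -> uu i = c \/ exists2 j, (j < i)%N & uu i \in ee j) ->
  exists F U r p rk, [/\ rooted F U c r p rk,
    forall i, (i < n)%N -> ee i \in F /\ r (ee i) = uu i &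
    forall f, f \in F -> exists2 i, (i < n)%N & f = ee i].
Proof.
elim: n => [|n IHn] eeE inj conn.
  exists set0, [set c], (fun=> c), (fun=> set0), (fun=> 0%N); split=> //; last first.
    by move=> f; rewrite inE.
  split; rewrite ?sub0set ?set11//; try by move=> e; rewrite inE.
  - by move=> u; rewrite inE => ->.
  - by move=> x y; rewrite !inE => /eqP-> /eqP->; exact: walk_refl.
have [||| F [U [r [p [rk [rt FI IF]]]]]] := IHn.
- by move=> i ni; apply: eeE; apply: ltnW.
- by move=> i j /andP[ij jn]; apply: inj; rewrite ij ltnW.
- by move=> i ni; apply: conn; apply: ltnW.
have [eE ue] := eeE n (ltnSn n).
have eF : ee n \notin F.
  by apply/negP => /IF[i ni /esym/eqP]; apply/negP/inj; rewrite ni /=.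
have uU : uu n \in U.
  have [->|[j jn uj]] := conn n (ltnSn n); first exact: rooted_center rt.
  by apply: (subsetP (rooted_cover rt (FI j jn).1)).
have [r' [p' [rk' [rt' re rF]]]] := rooted_extend rt eE eF ue uU.
exists (ee n |: F), (U :|: ee n), r', p', rk'; split=> // [i|f].
  rewrite ltnS leq_eqVlt => /predU1P[->|/FI[iF ri]]; first by rewrite !inE eqxx.
  by rewrite !inE iF orbT rF.
rewrite !inE => /predU1P[->|/IF[i ni ->]]; first by exists n.
by exists i => //; apply: ltnW.
Qed.

Hypothesis conn : connected E.
Hypothesis edge_neq0 : forall e, e \in E -> e != set0.

Lemma rooted_complete F U c r p rk : rooted F U c r p rk ->
  exists r' p' rk', rooted E [set: V] c r' p' rk' /\ forall f, f \in F -> r' f = r f.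
Proof.
have [n] := ubnP #|E :\: F|; elim: n => // n IHn in F U r p rk *.
rewrite ltnS => nF rt; have FE := rooted_edges rt.
(* A path from [c] to a vertex outside [U] has a step leaving [U]. Its edge is not in [F], because
   the edges of [F] lie inside [U]. *)
have cross y : y \notin U -> exists f u, [/\ f \in E, f \notin F, u \in f & u \in U].
  move=> yU; have [k [st0 /and3P[/and3P[inc0 _ _] /eqP l0 _]]] := conn c y.
  have step : forall st x, x \in U -> incid E x st -> last x (map snd st) = y ->
      exists f u, [/\ f \in E, f \notin F, u \in f & u \in U].
    elim=> [|[e v] st IHst] x xU /=; first by move=> _ xy; rewrite -xy xU in yU.
    move=> /and4P[eE xe ve inc]; have [vU|vU] := boolP (v \in U); first exact: IHst.
    move=> _; exists e, x; split=> //; apply: contra vU => eF.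
    exact: (subsetP (rooted_cover rt eF)).
  exact: step (rooted_center rt) inc0 l0.
have [EF|/subsetPn[e eE eF]] := boolP (E \subset F).
  have eqF : F = E by apply/eqP; rewrite eqEsubset FE.
  exists r, p, rk; split=> //; rewrite eqF in rt.
  suff <- : U = setT by [].
  apply/eqP; rewrite -subTset; apply/subsetP => y _; apply/negPn/negP => /cross.
  by case=> f [u [fE /negP[]]]; rewrite eqF.
have [f [u [fE fF uf uU]]] : exists f u, [/\ f \in E, f \notin F, u \in f & u \in U].
  have /set0Pn[y ye] := edge_neq0 eE; have [yU|/cross//] := boolP (y \in U).
  by exists e, y.
have [r' [p' [rk' [rt' re rF]]]] := rooted_extend rt fE fF uf uU.
have [|r'' [p'' [rk'' [rt'' rF'']]]] := IHn _ _ _ _ _ _ rt'.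
  apply: leq_trans nF; apply: proper_card; apply/properP; split.
    by apply: setDS; apply: subsetUr.
  by exists f; rewrite !inE ?fE ?fF ?eqxx.
exists r'', p'', rk''; split=> // g gF.
by rewrite rF'' ?rF// !inE gF orbT.
Qed.

(** The listed edges are attached first, in their order, which fixes their roots; the remaining
    edges are added afterwards and do not disturb them. *)
Lemma rooting c n (ee : nat -> {set V}) (uu : nat -> V) :
  (forall i, (i < n)%N -> ee i \in E /\ uu i \in ee i) ->
  (forall i j, (i < j < n)%N -> ee i != ee j) ->
  (forall i, (i < n)%N -> uu i = c \/ exists2 j, (j < i)%N & uu i \in ee j) ->
  exists r p rk, rooted E [set: V] c r p rk /\ forall i, (i < n)%N -> r (ee i) = uu i.
Proof.
move=> h1 h2 h3; have [F [U [r [p [rk [rt FI IF]]]]]] := rooted_sequence h1 h2 h3.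
have [r' [p' [rk' [rt' rF]]]] := rooted_complete rt.
exists r', p', rk'; split=> // i ni.
by have [iF <-] := FI i ni; rewrite rF.
Qed.

End Rooting.

(** * Counting weights of edges over the branches of a rooted hypertree *)

Section Loads.
Variables (V : finType) (E : {set {set V}}) (c : V).
Variables (r : {set V} -> V) (p : V -> {set V}) (rk : V -> nat).
Hypothesis rt : rooted E E [set: V] c r p rk.
Variable delta : {set V} -> nat.

Lemma load_exists : exists x : V -> nat, forall u,
  x u = \sum_(e in E | r e == u) (delta e + \sum_(v in e :\ r e) x v)%N.
Proof.
(* The recursion goes up in rank, so its iterates stabilize. *)
pose step (x : V -> nat) u := \sum_(e in E | r e == u) (delta e + \sum_(v in e :\ r e) x v)%N.
pose N := (\max_u rk u).+1.
have fix_iter n u : (N <= n + rk u)%N -> iter n.+1 step (fun=> 0%N) u = iter n step (fun=> 0%N) u.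
  elim: n u => [|n IHn] u Nu; first by rewrite ltnNge leq_bigmax in Nu.
  change (step (iter n.+1 step (fun=> 0%N)) u = step (iter n step (fun=> 0%N)) u).
  apply: eq_bigr => e /andP[eE /eqP re].
  congr (_ + _)%N; apply: eq_bigr => v; rewrite !inE => /andP[vr ve].
  apply: IHn; rewrite (leq_trans Nu)// addSnnS leq_add2l -re.
  exact: (rooted_rank rt).
exists (iter N step (fun=> 0%N)) => u; rewrite -[LHS]fix_iter ?leq_addr//.
Qed.

Variable x : V -> nat.
Hypothesis xE : forall u, x u = \sum_(e in E | r e == u) (delta e + \sum_(v in e :\ r e) x v)%N.

(** By the recursion for [x], this is the total of [delta] over the branch strictly below [e]. *)
Definition below (e : {set V}) : nat := \sum_(v in e :\ r e) x v.

(** Every vertex other than [c] is a child of exactly one edge, its parent. *)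
Lemma sum_children (f : V -> nat) :
  \sum_(e in E) \sum_(v in e :\ r e) f v = \sum_(v | v != c) f v.
Proof.
rewrite (exchange_big_dep (fun v => v != c)) /=; last first.
  by move=> e v eE; rewrite !inE => /andP[vr ve]; have [] := rooted_child rt eE ve vr.
apply: eq_bigr => v vc; have [pE vp vr] := rooted_parent rt (in_setT v) vc.
rewrite (bigD1 (p v)) /=; last by rewrite pE !inE vr.
rewrite big1 ?addn0// => e /andP[/andP[eE]]; rewrite !inE => /andP[vre ve] ep.
by have [_ pe] := rooted_child rt eE ve vre; rewrite pe eqxx in ep.
Qed.

(** When the recursion is summed over all vertices, the values of [x] away from [c] occur on both
    sides and cancel. *)
Lemma load_center : x c = \sum_(e in E) delta e.
Proof.
have h : (\sum_u x u = \sum_(e in E) (delta e + below e))%N.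
  rewrite (eq_bigr _ (fun u _ => xE u)) (exchange_big_dep (mem E)) /=; last by move=> u e _ /andP[].
  by apply: eq_bigr => e eE; rewrite (big_pred1 (r e))// => u; rewrite eE eq_sym.
move: h; rewrite big_split /= (sum_children x) (bigD1 c) //=.
by move/addIn.
Qed.

Lemma load_le_parent u : u != c -> (x u <= x (r (p u)))%N.
Proof.
move=> uc; have [pE up ur] := rooted_parent rt (in_setT u) uc.
rewrite [x (r _)]xE (bigD1 (p u)) ?pE ?eqxx//= (bigD1 u) ?inE ?ur//=.
by rewrite -!addnA addnCA leq_addr.
Qed.

Lemma load_le u : (x u <= \sum_(e in E) delta e)%N.
Proof.
rewrite -load_center; have [n] := ubnP (rk u); elim: n => // n IHn in u *.
rewrite ltnS => un; have [->//|uc] := eqVneq u c.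
have [pE up ur] := rooted_parent rt (in_setT u) uc.
apply: leq_trans (load_le_parent uc) (IHn _ _).
exact: leq_trans (rooted_rank rt pE up ur) un.
Qed.

Lemma load_edge_le e : e \in E -> (delta e + below e <= x (r e))%N.
Proof. by move=> eE; rewrite [x _]xE (bigD1 e) ?eE ?eqxx//= leq_addr. Qed.

Lemma below_le e : e \in E -> (below e <= \sum_(f in E) delta f)%N.
Proof.
move=> eE; apply: leq_trans (load_le (r e)).
by apply: leq_trans (load_edge_le eE); apply: leq_addl.
Qed.

End Loads.

Local Open Scope ring_scope.

(** * The real part of an algebraically closed numeric field *)

(** Unsuitable roots are divided out. A real root outside the interval gives factors of the same
    sign at [a] and [b], and a nonreal root with its conjugate gives a factor positive on the reals,
    so the sign change survives in the quotient. A constant has no sign change. *)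
Lemma real_poly_root_between (C : numClosedFieldType) (p : {poly C}) (a b : C) :
  map_poly Num.conj p = p -> a \is Num.real -> b \is Num.real ->
  p.[a] * p.[b] < 0 -> exists2 x, x \is Num.real & (a - x) * (b - x) <= 0 /\ root p x.
Proof.
have [n] := ubnP (size p); elim: n => // n IHn in p *.
rewrite ltnS => szp pJ aR bR pab.
have p_neq0 : p != 0 by apply: contraTneq pab => ->; rewrite !horner0 mulr0 ltxx.
have XJ c : map_poly Num.conj ('X - c%:P : {poly C}) = 'X - (c^*)%:P.
  by rewrite rmorphB /= map_polyX map_polyC.
have [z pz] : exists z, root p z.
  apply/closed_rootP; apply: contraTneq pab => /eqP/size_poly1P[c c0 cE].
  have cR : c \is Num.real.
    by rewrite CrealE; apply/eqP; rewrite -[c](coefC c 0) -cE -{2}pJ coef_map.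
  by rewrite cE !hornerC -expr2 real_ltNge ?rpredX ?rpred0// -realEsqr cR.
have [q pq] := factor_theorem _ _ pz.
have [zR|zNR] := boolP (z \is Num.real).
  have [zab|] := boolP ((a - z) * (b - z) <= 0); first by exists z.
  rewrite -real_ltNge ?rpredM ?rpredB ?rpred0// => zab.
  have [|||||x xR [xab qx]] := IHn q; last 1 first.
  - by exists x => //; rewrite pq rootM qx.
  - by apply: leq_trans szp; rewrite pq size_Mmonic ?monicXsubC ?size_XsubC ?addn2//;
       apply: contraNneq p_neq0 => q0; rewrite pq q0 mul0r.
  - apply: (@mulIf _ ('X - z%:P)).
      by rewrite polyXsubC_eq0.
    by rewrite -pq -pJ pq rmorphM /= XJ (CrealP zR).
  - exact: aR.
  - exact: bR.
  - move: pab; rewrite pq !hornerM !hornerXsubC mulrACA.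
    by rewrite pmulr_llt0.
have zz : z^* != z by rewrite -CrealE.
have : root p z^*.
  by rewrite -pJ /root horner_map /= fmorph_eq0.
rewrite {1}pq rootM root_XsubC (negPf zz) orbF => /factor_theorem[r qr].
have prE : p = r * (('X - (z^*)%:P) * ('X - z%:P)) by rewrite mulrA -qr.
have [|||||x xR [xab rx]] := IHn r; last 1 first.
- by exists x => //; rewrite prE rootM rx.
- apply: leq_trans szp; rewrite prE size_Mmonic ?monicMl ?monicXsubC//; last first.
    by apply: contraNneq p_neq0 => q0; rewrite prE q0 mul0r.
  by rewrite size_Mmonic ?monicXsubC ?polyXsubC_eq0// !size_XsubC addn3 /= ltnS leqnSn.
- apply: (@mulIf _ (('X - (z^*)%:P) * ('X - z%:P))).
    by rewrite mulf_neq0 ?polyXsubC_eq0.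
  rewrite -prE -pJ prE !rmorphM /= !XJ conjCK; congr (_ * _); exact: mulrC.
- exact: aR.
- exact: bR.
have pos c : c \is Num.real -> 0 < (('X - (z^*)%:P) * ('X - z%:P)).[c].
  move=> cR; rewrite hornerM !hornerXsubC.
  have -> : c - z^* = (c - z)^* by rewrite rmorphB /= (CrealP cR).
  rewrite mulrC -normCK exprn_gt0// normr_gt0 subr_eq0.
  by apply: contraNneq zNR => <-.
move: pab; rewrite prE !(hornerM r) mulrACA.
by rewrite pmulr_llt0// mulr_gt0// pos.
Qed.

Section RealPart.
Variable C : numClosedFieldType.

(** The real elements form a real closed field. The weights are constructed there, where
    intermediate values are available, and then mapped into [C]. *)
Record realPart := RealPart {realVal :> C; realValP : realVal \is Num.real}.

HB.instance Definition _ := [isSub for realVal].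
HB.instance Definition _ := [Choice of realPart by <:].
HB.instance Definition _ := [SubChoice_isSubIntegralDomain of realPart by <:].
HB.instance Definition _ := [SubIntegralDomain_isSubField of realPart by <:].

Definition real_le (x y : realPart) := realVal x <= realVal y.
Definition real_lt (x y : realPart) := realVal x < realVal y.
Definition real_norm (x : realPart) := RealPart (normr_real (realVal x)).

Fact real_le0D x y : real_le 0 x -> real_le 0 y -> real_le 0 (x + y).
Proof. exact: addr_ge0. Qed.
Fact real_le0M x y : real_le 0 x -> real_le 0 y -> real_le 0 (x * y).
Proof. exact: mulr_ge0. Qed.
Fact real_le0_anti x : real_le 0 x -> real_le x 0 -> x = 0.
Proof. by move=> x0 x1; apply/val_inj/le_anti/andP. Qed.
Fact real_sub_ge0 x y : real_le 0 (y - x) = real_le x y.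
Proof. exact: subr_ge0. Qed.
Fact real_le0_total x : real_le 0 x || real_le x 0.
Proof. exact: realValP. Qed.
Fact real_normN x : real_norm (- x) = real_norm x.
Proof. by apply/val_inj; apply: normrN. Qed.
Fact real_ge0_norm x : real_le 0 x -> real_norm x = x.
Proof. by move=> x0; apply/val_inj; apply: ger0_norm. Qed.
Fact real_lt_def x y : real_lt x y = (y != x) && real_le x y.
Proof. exact: lt_def. Qed.

HB.instance Definition _ := Num.IntegralDomain_isLeReal.Build realPart
  real_le0D real_le0M real_le0_anti real_sub_ge0 real_le0_total
  real_normN real_ge0_norm real_lt_def.

Fact realVal_zmod : zmod_morphism realVal. Proof. by []. Qed.
Fact realVal_monoid : monoid_morphism realVal. Proof. by []. Qed.
HB.instance Definition _ := GRing.isZmodMorphism.Build _ _ realVal realVal_zmod.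
HB.instance Definition _ := GRing.isMonoidMorphism.Build _ _ realVal realVal_monoid.

Fact realPart_ivt : Num.real_closed_axiom realPart.
Proof.
move=> p a b ab /andP[pa pb].
have [pa0|pa0] := eqVneq p.[a] 0.
  by exists a; rewrite ?lexx ?ab //; apply/rootP.
have [pb0|pb0] := eqVneq p.[b] 0.
  by exists b; rewrite ?lexx ?ab //; apply/rootP.
have [|||| x xR [xab px]] := @real_poly_root_between C (map_poly realVal p) a b.
- by apply/polyP => i; rewrite !coef_map /=; apply/CrealP/realValP.
- exact: realValP.
- exact: realValP.
- rewrite !horner_map /=; suff : p.[a] * p.[b] < 0 by [].
  by rewrite nmulr_rlt0 ?lt_def ?pb0 // eq_sym pa0.
have {}xab : (a - RealPart xR) * (b - RealPart xR) <= 0 by [].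
exists (RealPart xR); last first.
  move: px; rewrite /root -[x]/(realVal (RealPart xR)) horner_map /=.
  by rewrite -(rmorph0 realVal) => /eqP/val_inj/eqP.
have [lt_xa|le_ax] /= := ltP (RealPart xR) a.
  by have : 0 < (a - RealPart xR) * (b - RealPart xR); nra.
by rewrite leNgt; apply: contraTN xab => lt_bx; rewrite -ltNge; nra.
Qed.
HB.instance Definition _ := Num.RealField_isClosed.Build realPart realPart_ivt.
End RealPart.

(** * Loads along a path *)

Section RationalFunctions.
Variable R : rcfType.

(** This takes the place of continuity: the functions of [L] considered below are of this form, and
    they inherit the intermediate value property of polynomials. *)
Definition rational_on (f : R -> R) (a b : R) :=
  exists P Q : {poly R}, forall x, a <= x <= b -> Q.[x] != 0 /\ f x = P.[x] / Q.[x].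

Lemma rational_on_cst c a b : rational_on (fun=> c) a b.
Proof. by exists c%:P, 1 => x _; rewrite !hornerC oner_neq0 divr1. Qed.

Lemma rational_on_exp n a b : rational_on (fun x => x ^+ n) a b.
Proof. by exists 'X^n, 1 => x _; rewrite !hornerE oner_neq0 divr1. Qed.

Lemma rational_onD f g a b : rational_on f a b -> rational_on g a b ->
  rational_on (fun x => f x + g x) a b.
Proof.
move=> [P [Q fE]] [P' [Q' gE]]; exists (P * Q' + P' * Q), (Q * Q') => x xab.
have [Q0 ->] := fE x xab; have [Q'0 ->] := gE x xab.
by rewrite !hornerE mulf_neq0// addf_div.
Qed.

Lemma rational_onB f g a b : rational_on f a b -> rational_on g a b ->
  rational_on (fun x => f x - g x) a b.
Proof.
move=> fr [P [Q gE]]; apply: rational_onD => //.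
by exists (- P), Q => x /gE[Q0 ->]; rewrite hornerN mulNr.
Qed.

Lemma rational_onM f g a b : rational_on f a b -> rational_on g a b ->
  rational_on (fun x => f x * g x) a b.
Proof.
move=> [P [Q fE]] [P' [Q' gE]]; exists (P * P'), (Q * Q') => x xab.
have [Q0 ->] := fE x xab; have [Q'0 ->] := gE x xab.
by rewrite !hornerM mulf_neq0// mulf_div.
Qed.

Lemma rational_onV f a b : rational_on f a b ->
  (forall x, a <= x <= b -> f x != 0) -> rational_on (fun x => (f x)^-1) a b.
Proof.
move=> [P [Q fE]] f0; exists Q, P => x xab.
have := f0 x xab; have [Q0 ->] := fE x xab.
rewrite mulf_eq0 negb_or => /andP[-> _]; split=> //.
by rewrite invf_div.
Qed.

(** The polynomial [P * Q] is [f] times the square of [Q], so it has the signs and the zeros of [f]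
    on the interval. *)
Lemma rational_on_ivt f a b : a <= b -> rational_on f a b -> f a <= 0 -> 0 <= f b ->
  exists2 x, a <= x <= b & f x = 0.
Proof.
move=> ab [P [Q fE]] fa fb.
have PQ x : a <= x <= b -> (P * Q).[x] = f x * Q.[x] ^+ 2.
  by move=> /fE[Q0 ->]; rewrite hornerM expr2 mulrA divfK.
have aab : a <= a <= b by rewrite lexx.
have bab : a <= b <= b by rewrite lexx andbT.
have [||x xab] := @poly_ivt R (P * Q) a b => //.
  by rewrite !PQ// mulr_ge0 ?sqr_ge0// andbT mulr_le0_ge0 ?sqr_ge0.
rewrite /root PQ// mulf_eq0 expf_eq0 /= (negPf (fE x xab).1) orbF => /eqP.
by exists x.
Qed.

End RationalFunctions.

Section Levels.
Variables (R : rcfType) (q : nat) (alpha c : R).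
Hypotheses (alpha_ge0 : 0 <= alpha) (c_gt0 : 0 < c).

(* With [lam = L + alpha] and [c = (1 - alpha) ^+ q.+2], the load forced at the root of a loose
   path with [j] edges by the vertex and product conditions; the value 0 at [j = 0] stands
   for the absence of a branch. *)
Fixpoint level (L : R) (j : nat) : R :=
  if j is j'.+1 then alpha + c / (L ^+ q * (L - level L j')) else 0.

Local Notation w := level.

(** These inequalities make the denominators in the levels 1 to [j] positive; since the level 0 is
    0, they include [0 < L] as soon as [j] is positive. *)
Definition admissible L j := forall i, (i < j)%N -> w L i < L.

Lemma admissible_gt0 L j : admissible L j.+1 -> 0 < L.
Proof. by move=> /(_ 0%N isT). Qed.

Lemma admissible_le L i j : (i <= j)%N -> admissible L j -> admissible L i.
Proof. by move=> ij Lj h hi; apply: Lj; apply: leq_trans ij. Qed.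

Lemma admissibleS L j : admissible L j -> w L j < L -> admissible L j.+1.
Proof. by move=> Lj wj i; rewrite ltnS leq_eqVlt => /predU1P[->//|/Lj]. Qed.

Lemma level_ge0 L j : admissible L j -> 0 <= w L j.
Proof.
case: j => [|j] Lj //=; have L0 := admissible_gt0 Lj.
have : 0 < L - w L j by rewrite subr_gt0 Lj.
move=> wj; rewrite addr_ge0// ltW// divr_gt0// mulr_gt0// exprn_gt0//.
Qed.

Lemma level_anti L M j : admissible L j -> L <= M -> w M j <= w L j.
Proof.
elim: j => [|j IHj] //= Lj LM; have L0 := admissible_gt0 Lj.
have {}IHj := IHj (admissible_le (leqnSn j) Lj) LM.
have wj := Lj j (ltnSn j).
have Lq : 0 < L ^+ q by rewrite exprn_gt0.
rewrite lerD2l ler_pM2l// lef_pV2 ?posrE ?mulr_gt0// ?subr_gt0//; last 2 first.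
- by rewrite exprn_gt0// (lt_le_trans L0).
- by rewrite (le_lt_trans IHj)// (lt_le_trans wj).
rewrite ler_pM ?(ltW Lq) ?subr_ge0 ?(ltW wj)//; last by lra.
by rewrite lerXn2r ?nnegrE// (le_trans (ltW L0)).
Qed.

Lemma admissible_up L M j : admissible L j -> L <= M -> admissible M j.
Proof.
move=> Lj LM i ij; apply: (le_lt_trans (y := w L i)).
  by apply: level_anti => //; apply: admissible_le Lj; apply: ltnW.
by apply: lt_le_trans LM; apply: Lj.
Qed.

Lemma rational_on_level a b j : (forall x, a <= x <= b -> admissible x j) ->
  rational_on (fun x => w x j) a b.
Proof.
elim: j => [|j IHj] ad /=; first exact: rational_on_cst.
have adj x : a <= x <= b -> admissible x j.
  by move=> /ad; apply: admissible_le.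
apply: rational_onD; first exact: rational_on_cst.
apply: rational_onM; first exact: rational_on_cst.
apply: rational_onV => [|x xab].
  apply: rational_onM; first exact: rational_on_exp.
  by apply: rational_onB; [exact: rational_on_exp 1%N _ _|exact: IHj].
have xj := ad x xab; rewrite mulf_neq0// ?expf_neq0//.
  by rewrite gt_eqF// (admissible_gt0 xj).
by rewrite subr_eq0 gt_eqF// xj.
Qed.

(** The point [l] is a pole of the level [j.+1]. To the right of it the fraction
    [c / (x ^+ q * (x - w x j))] falls from infinity and meets [x] where [g] vanishes. *)
Lemma level_peak j l : 0 <= l -> admissible l j -> w l j = l ->
  exists2 l', admissible l' j.+1 & w l' j.+1 = alpha + l'.
Proof.
move=> l0 lj wl; have c0 := c_gt0.
have up x : l < x -> admissible x j.+1.
  move=> lx; apply: admissibleS; first by apply: admissible_up lj (ltW lx).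
  by apply: (le_lt_trans _ lx); rewrite -[leRHS]wl; exact: level_anti (ltW lx).
pose g x := x ^+ q * x * (x - w x j) - c.
(* At [l + (1 + c)] both [x] and [x - w x j] are at least [1 + c], because [w x j <= l] there; hence
   the product in [g] exceeds [c]. *)
have lM : l <= l + (1 + c) by lra.
have [|||x xab gx] := @rational_on_ivt R g l (l + (1 + c)) lM.
- apply: rational_onB; last exact: rational_on_cst.
  apply: rational_onM.
    by apply: rational_onM; [exact: rational_on_exp|exact: rational_on_exp 1%N _ _].
  apply: rational_onB; first exact: rational_on_exp 1%N _ _.
  apply: rational_on_level => x /andP[lx _]; exact: admissible_up lj lx.
- by rewrite /g wl subrr mulr0 sub0r oppr_le0 ltW.
- rewrite /g subr_ge0; set x := l + _.
  have x1 : 1 + c <= x by rewrite /x; lra.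
  have wx : 1 + c <= x - w x j.
    have := level_anti lj lM; rewrite wl /x -/x => h; rewrite /x; lra.
  have xq : 1 <= x ^+ q by rewrite exprn_ege1//; lra.
  have h1 : 1 + c <= x ^+ q * x by nra.
  by nra.
have lx : l < x.
  have /andP[lx _] := xab; rewrite lt_neqAle lx andbT; apply: contraPneq gx => <-.
  by rewrite /g wl subrr mulr0 sub0r => /eqP; rewrite oppr_eq0 gt_eqF.
exists x; first exact: up.
have x0 : 0 < x by lra.
have wx : 0 < x - w x j by rewrite subr_gt0; apply: (up _ lx).
have xq : 0 < x ^+ q by rewrite exprn_gt0.
rewrite /=; congr (_ + _); apply/eqP; rewrite eq_sym; apply/eqP.
apply: (canRL (mulfK _)); first by rewrite mulf_neq0// gt_eqF.
by move: gx; rewrite /g => /subr0_eq <-; ring.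
Qed.

(** At the point [l'] of [level_peak], [x - w x j.+1] equals [- alpha]; since levels decrease in
    [x], it is nonnegative at [l' + alpha]. *)
Lemma level_fixpoint j : exists l, [/\ 0 <= l, admissible l j & w l j = l].
Proof.
have a0 := alpha_ge0; elim: j => [|j [l [l0 lj wl]]]; first by exists 0; split.
have [l' l'j wl'] := level_peak l0 lj wl.
have l'0 : 0 < l' := admissible_gt0 l'j.
have up x : l' <= x -> admissible x j.+1 by apply: admissible_up.
have [||||x /andP[xl xu] /subr0_eq fx] :=
    @rational_on_ivt R (fun x => x - w x j.+1) l' (l' + alpha).
- by lra.
- apply: rational_onB; first exact: rational_on_exp 1%N _ _.
  by apply: rational_on_level => x /andP[/up].
- by rewrite wl'; lra.
- have h : l' <= l' + alpha by lra.
  by have := level_anti l'j h; rewrite wl'; lra.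
exists x; split => //; [lra|exact: up].
Qed.

(** At the point of [level_peak] the level of index [t] alone equals the left side, so the right
    side is at least as large. Raising [L] by the remaining terms [b] raises the left side by [b]
    while no level increases, which reverses the inequality. *)
Lemma level_balance s t M : (0 < s <= t)%N ->
  exists2 L, admissible L t & L + alpha = w L s + w L t + M%:R * w L 1.
Proof.
case: t => [|t] /andP[s0 st]; first by case: s s0 st.
have a0 := alpha_ge0.
have [l [l0 lt wl]] := level_fixpoint t; have [l' l't wl'] := level_peak l0 lt wl.
have up x : l' <= x -> admissible x t.+1 by apply: admissible_up.
have ups x : l' <= x -> admissible x s by move/up; apply: admissible_le.
have up1 x : l' <= x -> admissible x 1 by move/up; apply: admissible_le.
have w1 : 0 <= M%:R * w l' 1 by rewrite mulr_ge0 ?ler0n// (level_ge0 (up1 _ (lexx _))).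
have ws : 0 <= w l' s := level_ge0 (ups _ (lexx _)).
set b := w l' s + M%:R * w l' 1.
pose f x := x + alpha - (w x s + w x t.+1 + M%:R * w x 1).
have lb : l' <= l' + b by rewrite /b; lra.
have [|||x /andP[xl xu] /subr0_eq fx] := @rational_on_ivt R f l' (l' + b) lb.
- apply: rational_onB; last apply: rational_onD.
  + by apply: rational_onD; [exact: rational_on_exp 1%N _ _|exact: rational_on_cst].
  + by apply: rational_onD; apply: rational_on_level => x /andP[]; [move/ups|move/up].
  + apply: rational_onM; first exact: rational_on_cst.
    by apply: rational_on_level => x /andP[/up1].
- by rewrite /f wl'; lra.
- rewrite /f; have h := level_anti (up _ (lexx _)) lb.
  have hs := level_anti (ups _ (lexx _)) lb.
  have h1 : M%:R * w (l' + b) 1 <= M%:R * w l' 1.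
    by rewrite ler_wpM2l ?ler0n//; exact: level_anti (up1 _ (lexx _)) lb.
  by move: h; rewrite wl' {-1}/b; lra.
by exists x; [exact: up|].
Qed.
End Levels.
(** This is the Weierstrass product inequality for the numbers [y i / L], in homogeneous form. *)
Lemma ler_prod_subr (R : realFieldType) (I : eqType) (L : R) (r : seq I) (y : I -> R) :
  0 <= L -> (forall i, i \in r -> 0 <= y i) -> \sum_(i <- r) y i <= L ->
  L ^+ size r * (L - \sum_(i <- r) y i) <= L * \prod_(i <- r) (L - y i).
Proof.
move=> L0; elim: r => [|i r IHr] y0 yL; first by rewrite !big_nil expr0 mul1r mulr1 subr0.
move: yL; rewrite !big_cons => yL; have yi0 := y0 i (mem_head _ _).
have yr0 j : j \in r -> 0 <= y j by move=> jr; rewrite y0// in_cons jr orbT.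
have s0 : 0 <= \sum_(j <- r) y j by rewrite big_seq sumr_ge0.
have {IHr} IH := IHr yr0 _; set S := \sum_(j <- r) y j in yL s0 IH *.
rewrite mulrCA; apply: (le_trans _ (ler_wpM2l _ (IH _))); [|lra|lra].
have Lr : 0 <= L ^+ size r by rewrite exprn_ge0.
rewrite /= exprSr [leRHS]mulrCA -mulrA ler_wpM2l//; nra.
Qed.

Lemma ler_prod_sub (R : realFieldType) (I : finType) (L : R) (A : {set I}) (y : I -> R) :
  0 <= L -> (forall i, i \in A -> 0 <= y i) -> \sum_(i in A) y i <= L ->
  L ^+ #|A| * (L - \sum_(i in A) y i) <= L * \prod_(i in A) (L - y i).
Proof.
move=> L0 y0; rewrite -!big_enum cardE => yL /=.
by apply: ler_prod_subr => // i; rewrite mem_enum; apply: y0.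
Qed.

(** Splitting off [y i] and applying the inequality to the other terms, with sum [S], gives
    [y i * S <= 0]. *)
Lemma eq_prod_sub (R : realFieldType) (I : finType) (L : R) (A : {set I}) (y : I -> R) i :
  0 < L -> (forall i, i \in A -> 0 <= y i) -> \sum_(i in A) y i <= L ->
  L * \prod_(i in A) (L - y i) = L ^+ #|A| * (L - \sum_(i in A) y i) ->
  i \in A -> 0 < y i -> forall j, j \in A -> j != i -> y j = 0.
Proof.
move=> L0 y0 yL + iA yi.
move: yL; rewrite !(big_setD1 i iA) (cardsD1 i) iA /= => yL eqL.
have y0' j : j \in A :\ i -> 0 <= y j by rewrite inE => /andP[_ /y0].
have S0 : 0 <= \sum_(j in A :\ i) y j by rewrite sumr_ge0.
have := ler_prod_sub (ltW L0) y0'; set S := \sum_(j in A :\ i) y j in yL eqL S0 *.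
move=> IH; have {}IH : L ^+ #|A :\ i| * (L - S) <= L * \prod_(j in A :\ i) (L - y j).
  by apply: IH; lra.
suff S_eq0 : S = 0.
  by move=> j jA ji; apply: (psumr_eq0P y0' S_eq0); rewrite !inE ji.
have Lr : 0 < L ^+ #|A :\ i| by rewrite exprn_gt0.
have : (L - y i) * (L ^+ #|A :\ i| * (L - S)) <= L ^+ #|A :\ i|.+1 * (L - (y i + S)).
  by rewrite -add1n -eqL [leRHS]mulrCA; apply: ler_wpM2l => //; lra.
rewrite exprSr mulrCA -mulrA ler_pM2l// => h; nra.
Qed.

Section Balance.
Variables (R : rcfType) (q : nat) (alpha c : R).
Hypotheses (alpha_ge0 : 0 <= alpha) (c_gt0 : 0 < c).
Variables (L : R) (s t M : nat).
Local Notation w := (level q alpha c L).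
Hypotheses (st : (0 < s <= t)%N) (ts : (t <= s.+1)%N) (adm : admissible q alpha c L t).
Hypothesis balance : L + alpha = w s + w t + M%:R * w 1%N.

Lemma balance_gt0 : 0 < L.
Proof. by case: t adm st => [|t']; [case: s|move=> /admissible_gt0]. Qed.

Lemma level_gt_alpha j : (j < t)%N -> alpha < w j.+1.
Proof.
move=> jt; rewrite /= ltrDl divr_gt0// mulr_gt0 ?exprn_gt0 ?balance_gt0//.
by rewrite subr_gt0 adm.
Qed.

Lemma level_ltS j : (j < t)%N -> w j < w j.+1.
Proof.
elim: j => [|j IHj] jt.
  exact: le_lt_trans alpha_ge0 (level_gt_alpha jt).
have L0 := balance_gt0; have wj := IHj (ltnW jt).
have wL i : (i < t)%N -> 0 < L - w i by move=> it; rewrite subr_gt0 adm.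
have Lq : 0 < L ^+ q by rewrite exprn_gt0.
have h0 : 0 < L - w j by rewrite wL// ltnW.
have h1 : 0 < L - w j.+1 by exact: wL.
change (alpha + c / (L ^+ q * (L - w j)) < alpha + c / (L ^+ q * (L - w j.+1))).
by rewrite ltrD2l ltr_pM2l// ltf_pV2 ?posrE ?mulr_gt0// ltr_pM2l//; lra.
Qed.

Lemma level_le i j : (i <= j <= t)%N -> w i <= w j.
Proof.
elim: j => [|j IHj] /andP[ij jt]; first by move: ij; rewrite leqn0 => /eqP->.
move: ij; rewrite leq_eqVlt => /predU1P[->//|ij].
by rewrite (le_trans (IHj _)) ?(ltW (level_ltS jt))// -ltnS ij ltnW.
Qed.

Lemma level_eqS j : (j < t)%N -> (w j.+1 - alpha) * (L ^+ q * (L - w j)) = c.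
Proof.
move=> jt; rewrite /= addrC addKr divfK// mulf_neq0//.
  by rewrite expf_neq0// gt_eqF// balance_gt0.
by rewrite subr_eq0 gt_eqF// adm.
Qed.

Lemma level1_gt0 : 0 < w 1%N.
Proof.
apply: le_lt_trans alpha_ge0 (level_gt_alpha _).
by case/andP: st => s0; apply: leq_trans.
Qed.

(** By the balance equation [L] is [w s + M%:R * w 1] plus the positive number [w t - alpha], and
    [h < t <= s.+1] gives [w h <= w s]. *)
Lemma level_load_lt h x : (h < t)%N -> (x <= M)%N -> w h + x%:R * w 1%N < L.
Proof.
move=> ht xM; have w1 := level1_gt0.
have hs : w h <= w s by rewrite level_le// -ltnS (leq_trans ht)//=; case/andP: st.
have tpos : (0 < t)%N by apply: leq_ltn_trans ht.
have wt : alpha < w t by rewrite -(prednK tpos) level_gt_alpha// prednK.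
have : x%:R * w 1%N <= M%:R * w 1%N by rewrite ler_pM2r// ler_nat.
by move: balance; lra.
Qed.

(** Adding [y = x%:R * w 1] to both levels changes the product by [L ^+ q * y * (L + alpha - w h - w
    h.+1 - y)]. The balance equation makes the last factor nonnegative, because [w h <= w s],
    [w h.+1 <= w t] and [x <= M]; it vanishes only if all three are equalities, and then [h = s < t]
    forces [t = s.+1]. *)
Lemma balance_edge h x : (h < t)%N -> (x <= M)%N ->
  c <= (w h.+1 + x%:R * w 1%N - alpha) * (L ^+ q * (L - (w h + x%:R * w 1%N))) /\
  (c = (w h.+1 + x%:R * w 1%N - alpha) * (L ^+ q * (L - (w h + x%:R * w 1%N))) ->
   x = 0%N \/ [/\ x = M, h = s & t = s.+1]).
Proof.
move=> ht xM; have w1 := level1_gt0; have L0 := balance_gt0.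
have Lq : 0 < L ^+ q by rewrite exprn_gt0.
have hs' : (h <= s)%N by rewrite -ltnS (leq_trans ht).
have [s0 st'] := andP st.
have hs : w h <= w s by rewrite level_le// hs'.
have ht' : w h.+1 <= w t by rewrite level_le// ht leqnn.
have := level_eqS ht; set W := w h.+1 in ht' *; set y := x%:R * w 1%N.
have yM : y <= M%:R * w 1%N by rewrite ler_pM2r// ler_nat.
have y0 : 0 <= y by rewrite mulr_ge0 ?ler0n// ltW.
have B := balance.
have -> : (W + y - alpha) * (L ^+ q * (L - (w h + y))) =
    (W - alpha) * (L ^+ q * (L - w h)) + L ^+ q * (y * (L + alpha - w h - W - y)) by ring.
move=> ->; split.
  by rewrite lerDl mulr_ge0 ?(ltW Lq)// mulr_ge0//; lra.
move=> /eqP; rewrite -subr_eq0 opprD addrA subrr sub0r oppr_eq0 mulf_eq0 (gt_eqF Lq) mulf_eq0 /=.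
case/orP => [|/eqP e].
  by rewrite mulf_eq0 pnatr_eq0 (gt_eqF w1) orbF => /eqP; left.
right; have yE : y = M%:R * w 1%N by lra.
have xE : x = M.
  by move/(mulIf (lt0r_neq0 w1)): yE => /eqP; rewrite eqr_nat => /eqP.
have hE : h = s.
  apply/eqP; rewrite eqn_leq hs' leqNgt; apply/negP => hs2.
  have : w h < w s.
    by apply: lt_le_trans (level_ltS ht) (level_le _); rewrite hs2 st'.
  by lra.
split=> //; apply/eqP; rewrite eqn_leq ts /= leqNgt; apply/negP => hs2.
by move: ht; rewrite hE ltnNge -ltnS hs2.
Qed.

End Balance.

(** * Edge weights and eigenvalues *)

Section TensorAction.
Variables (C : numClosedFieldType) (V : finType) (E : {set {set V}}) (k : nat).
Hypotheses (k_gt0 : (0 < k)%N) (Ek : uniform E k).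

Lemma set_cons_tuple_eq n (i : V) (t : n.-tuple V) (e : {set V}) :
  i \in e -> #|e| = n.+1 ->
  ([set x in i :: t] == e) = all (mem (e :\ i)) t && uniq t.
Proof.
move=> ie en; apply/eqP/andP => [eE|[/allP te ut]].
  have : uniq (i :: t) by apply/card_uniqP; rewrite /= size_tuple -en -eE cardsE.
  rewrite /= => /andP[it ->]; split=> //; apply/allP => j jt.
  rewrite !inE -eE !inE jt orbT andbT; by apply: contraNneq it => <-.
have it : i \notin t by apply/negP => /te; rewrite !inE eqxx.
apply/eqP; rewrite eqEcard; apply/andP; split.
  apply/subsetP => j; rewrite !inE => /predU1P[->//|/te]; by rewrite !inE => /andP[].
rewrite en cardsE (card_uniqP _) /= ?size_tuple//; by rewrite it ut.
Qed.

(** An edge containing [i] is met once for each of the [(k-1)!] orderings of its other vertices,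
    which cancels the factor in [adjT]. *)
Lemma sum_adjT (x : V -> C) (i : V) :
  \sum_(t : (k.-1).-tuple V) adjT C E k (i :: t) * \prod_(j <- t) x j =
  \sum_(e in E | i \in e) \prod_(j in e :\ i) x j.
Proof.
transitivity (\sum_(t : (k.-1).-tuple V) \sum_(e in E | i \in e)
    if [set z in i :: t] == e then ((k.-1)`!)%:R^-1 * \prod_(j in e :\ i) x j else 0).
  apply: eq_bigr => t _; rewrite /adjT; set S := [set z in i :: t].
  have iS : i \in S by rewrite !inE eqxx.
  case: ifPn => [SE|SE]; last first.
    rewrite mul0r big1// => e /andP[eE _]; case: eqP => // Se.
    by rewrite Se eE in SE.
  rewrite (bigD1 S) /=; last by rewrite SE.
  rewrite eqxx [X in _ + X]big1 ?addr0 => [|e]; last first.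
    by rewrite andbC eq_sym; case: eqP.
  have Sk : #|S| = k.-1.+1 by rewrite prednK// Ek.
  have /esym := set_cons_tuple_eq t iS Sk; rewrite eqxx => /andP[/allP tS ut].
  congr (_ * _); rewrite (big_uniq _ ut) /=; apply: eq_bigl => j.
  apply/idP/idP => [/tS//|]; rewrite /S !inE => /andP[/negPf-> /=]; by [].
rewrite exchange_big /=; apply: eq_bigr => e /andP[eE ie].
rewrite -big_mkcond /=.
rewrite (eq_bigl (mem [set t : (k.-1).-tuple V | all (mem (e :\ i)) t & uniq t])).
  rewrite sumr_const card_uniq_tuples; have -> : #|mem (e :\ i)| = k.-1.
    by have := cardsD1 i e; rewrite ie (Ek eE) => ->.
  by rewrite ffactnn -mulrnAl -mulr_natl divff ?mul1r// pnatr_eq0 -lt0n fact_gt0.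
by move=> t; rewrite set_cons_tuple_eq ?inE// (Ek eE) prednK.
Qed.

Lemma sum_degT (x : V -> C) (i : V) :
  \sum_(t : (k.-1).-tuple V) degT C E (i :: t) * \prod_(j <- t) x j =
  (degree E i)%:R * x i ^+ k.-1.
Proof.
rewrite (bigD1 [tuple of nseq k.-1 i]) //=.
have -> : all (fun j => j == i) (nseq k.-1 i) by apply/allP => j; rewrite mem_nseq => /andP[].
rewrite [X in _ + X]big1 ?addr0; first by rewrite big_nseq -Monoid.iteropE.
move=> t tn; case: ifPn => [/all_pred1P te|]; last by rewrite mul0r.
by case/eqP: tn; apply/val_inj; rewrite /= te size_tuple.
Qed.

Lemma tapp_AalphaT (alpha : C) (x : V -> C) (i : V) :
  tapp k (AalphaT E k alpha) x i =
  alpha * ((degree E i)%:R * x i ^+ k.-1) +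
  (1 - alpha) * \sum_(e in E | i \in e) \prod_(j in e :\ i) x j.
Proof.
rewrite -sum_degT -sum_adjT !mulr_sumr -big_split /=.
by apply: eq_bigr => t _; rewrite /AalphaT mulrDl !mulrA.
Qed.

(** After multiplication by [x i] the edge term is the monomial of the whole edge, the same for all
    its vertices. *)
Lemma tapp_AalphaT_mul (alpha : C) (x : V -> C) (i : V) :
  tapp k (AalphaT E k alpha) x i * x i =
  \sum_(e in E | i \in e) (alpha * x i ^+ k + (1 - alpha) * \prod_(j in e) x j).
Proof.
rewrite tapp_AalphaT mulrDl -!mulrA -exprSr prednK// big_split /=; congr (_ + _).
  rewrite sumr_const /degree mulrCA mulr_natl; congr (_ *+ _).
  by apply: eq_card => e; rewrite !inE.
rewrite -mulr_sumr; congr (_ * _); rewrite mulr_suml; apply: eq_bigr => e /andP[_ ie].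
by rewrite (big_setD1 i ie) mulrC.
Qed.

End TensorAction.

Section Weights.
Variables (C : numClosedFieldType) (V : finType) (E : {set {set V}}) (k : nat).
Hypotheses (k_gt0 : (0 < k)%N) (Ek : uniform E k).
Variables (alpha lam : C) (B : V -> {set V} -> C).
Hypotheses (alpha_ge0 : 0 <= alpha) (alpha_lt1 : alpha < 1).
Hypothesis B_gt0 : forall e i, e \in E -> i \in e -> 0 < B i e.

(* AM-GM applied to the numbers [B i e * z i ^+ k], whose product is at least [z^e ^+ k]. *)
Lemma weighted_AGM (z : V -> C) (e : {set V}) : (forall i, 0 <= z i) -> e \in E ->
  1 <= \prod_(i in e) B i e ->
  (\prod_(i in e) z i) *+ k <= \sum_(i in e) B i e * z i ^+ k /\
  ((\prod_(i in e) z i) *+ k = \sum_(i in e) B i e * z i ^+ k ->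
   (forall i, i \in e -> z i = 0) \/
   ((forall i, i \in e -> z i != 0) /\ \prod_(i in e) B i e = 1)).
Proof.
move=> z0 eE B1; have ke := Ek eE.
have y0 i : i \in e -> 0 <= B i e * z i ^+ k.
  by move=> ie; rewrite mulr_ge0 ?exprn_ge0// ltW// B_gt0.
have ze0 : 0 <= \prod_(i in e) z i by rewrite prodr_ge0.
set S := \sum_(i in e) _.
have S0 : 0 <= S by rewrite sumr_ge0.
have k0 : (0 : C) < k%:R by rewrite ltr0n.
have [AGM _] := leif_AGM y0.
rewrite ke -/S big_split /= prodrXl in AGM.
have zk : (\prod_(i in e) z i) ^+ k <= (S / k%:R) ^+ k.
  by apply: le_trans AGM; rewrite ler_peMl ?exprn_ge0.
have zS : \prod_(i in e) z i <= S / k%:R.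
  by rewrite -(ler_pXn2r k_gt0) ?nnegrE// divr_ge0// ltW.
split; first by rewrite -mulr_natr -ler_pdivlMr.
move=> eqS; have [z1|z1] := eqVneq (\prod_(i in e) z i) 0.
  left=> i ie; move/esym/eqP: eqS; rewrite z1 mul0rn psumr_eq0// => /allP/(_ i).
  rewrite mem_index_enum ie => /(_ isT); rewrite mulf_eq0 gt_eqF ?B_gt0//=.
  by rewrite expf_eq0 k_gt0 => /eqP.
right; split; first by move=> i ie; apply: contraNneq z1 => zi; rewrite (bigD1 i)//= zi mul0r.
apply/eqP; rewrite eq_le B1 andbT.
have zk0 : 0 < (\prod_(i in e) z i) ^+ k by rewrite exprn_gt0// lt_def z1.
rewrite -(ler_pM2r zk0) mul1r (le_trans AGM)//.
by rewrite -eqS -mulr_natr mulfK// gt_eqF.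
Qed.

(** The eigenvalue equations, multiplied by [x i], are bounded by moduli, summed over the vertices
    and regrouped by edges, where AM-GM applies. Equality of the totals gives equality on every
    edge. *)
Lemma eigenvalue_le_weight :
  (forall i, \sum_(e in E | i \in e) (alpha + (1 - alpha) * B i e) = lam) ->
  (forall e, e \in E -> 1 <= \prod_(i in e) B i e) ->
  forall l, is_eigenvalue k (AalphaT E k alpha) l ->
  `|l| <= lam /\
  (connected E -> `|l| = lam -> forall e, e \in E -> \prod_(i in e) B i e = 1).
Proof.
move=> Blam B1 l [x [[i0 xi0] xl]]; pose z i := `|x i|.
have z0 i : 0 <= z i by exact: normr_ge0.
have g0 : 0 < 1 - alpha by rewrite subr_gt0.
have sub i : `|l| * z i ^+ k <=
    \sum_(e in E | i \in e) (alpha * z i ^+ k + (1 - alpha) * \prod_(j in e) z j).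
  rewrite -[in leLHS](prednK k_gt0) exprSr mulrA -!normrX -normrM -xl -normrM.
  rewrite (tapp_AalphaT_mul k_gt0 Ek) (le_trans (ler_norm_sum _ _ _))//.
  apply: ler_sum => e _; rewrite (le_trans (ler_normD _ _))//.
  by rewrite !normrM normrX normr_prod (ger0_norm alpha_ge0) (ger0_norm (ltW g0)).
have swap (F : V -> {set V} -> C) :
    \sum_i \sum_(e in E | i \in e) F i e = \sum_(e in E) \sum_(i in e) F i e.
  rewrite (exchange_big_dep (mem E)) /=; last by move=> i e _ /andP[].
  by apply: eq_bigr => e eE; apply: eq_bigl => i; rewrite eE.
pose S := \sum_i z i ^+ k.
have lS : `|l| * S <= \sum_i \sum_(e in E | i \in e)
    (alpha * z i ^+ k + (1 - alpha) * \prod_(j in e) z j).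
  by rewrite mulr_sumr ler_sum.
have lamS : \sum_i \sum_(e in E | i \in e)
    (alpha * z i ^+ k + (1 - alpha) * (B i e * z i ^+ k)) = lam * S.
  rewrite mulr_sumr; apply: eq_bigr => i _; rewrite -(Blam i) mulr_suml.
  by apply: eq_bigr => e _; rewrite [RHS]mulrDl mulrA.
have edge e : e \in E ->
    \sum_(i in e) (alpha * z i ^+ k + (1 - alpha) * \prod_(j in e) z j) <=
    \sum_(i in e) (alpha * z i ^+ k + (1 - alpha) * (B i e * z i ^+ k)) ?= iff
    ((\prod_(i in e) z i) *+ k == \sum_(i in e) B i e * z i ^+ k).
  move=> eE; rewrite !big_split /= -!mulr_sumr sumr_const Ek//.
  have [h _] := weighted_AGM z0 eE (B1 e eE).
  split; first by rewrite lerD2l ler_pM2l.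
  rewrite (inj_eq (addrI _)) (inj_eq (mulfI _))//; by rewrite gt_eqF.
have [tot totE] : \sum_(e in E) \sum_(i in e) (alpha * z i ^+ k + (1 - alpha) * \prod_(j in e) z j)
  <= lam * S ?= iff [forall (e | e \in E),
    (\prod_(i in e) z i) *+ k == \sum_(i in e) B i e * z i ^+ k].
  by rewrite -lamS swap; apply: leif_sum.
have S0 : 0 < S.
  rewrite /S (bigD1 i0)//= ltr_pwDl ?exprn_gt0 ?normr_gt0// sumr_ge0// => i _.
  by rewrite exprn_ge0.
rewrite swap in lS; split; first by rewrite -(ler_pM2r S0) (le_trans lS).
move=> conn lE; rewrite lE in lS.
move: totE; rewrite eq_le tot lS => /esym/forall_inP eqE.
(* On each edge the moduli now vanish everywhere or nowhere, and connectedness carries the nonzero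
   entry [i0] to all vertices. This excludes the first alternative. *)
have cases e (eE : e \in E) := (weighted_AGM z0 eE (B1 e eE)).2 (eqP (eqE e eE)).
have z_neq0 : forall st u, z u != 0 -> incid E u st -> z (last u (map snd st)) != 0.
  elim=> [|[e v] st IHst] u zu //= /and4P[eE ue ve inc]; apply: IHst inc.
  case: (cases e eE) => [ze|[ze _]]; last exact: ze.
  by rewrite ze ?eqxx in zu.
have all_neq0 v : z v != 0.
  have [n [st /and3P[/and3P[inc _ _] /eqP <- _]]] := conn i0 v.
  by apply: z_neq0 inc; rewrite normr_eq0.
move=> e eE; case: (cases e eE) => [ze|[]//].
have /card_gt0P[v ve] : (0 < #|e|)%N by rewrite Ek.
by have := all_neq0 v; rewrite ze ?eqxx.
Qed.

(** The eigenvector consists of the [k]-th roots of [X]. Multiplying [X i * B i e = T e] over [e]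
    shows that its monomial on [e] has [k]-th power [T e ^+ k], hence equals [T e]. *)
Lemma weight_eigenvalue (X : V -> C) (T : {set V} -> C) :
  (forall i, \sum_(e in E | i \in e) (alpha + (1 - alpha) * B i e) = lam) ->
  (forall e, e \in E -> \prod_(i in e) B i e = 1) ->
  (forall i, 0 < X i) ->
  (forall e i, e \in E -> i \in e -> X i * B i e = T e) ->
  V -> is_eigenvalue k (AalphaT E k alpha) lam.
Proof.
move=> Blam B1 X0 XT i0; pose x i := k.-root (X i).
have xk i : x i ^+ k = X i by rewrite /x rootCK.
have x0 i : 0 < x i by rewrite /x rootC_gt0.
exists x; split; first by exists i0; rewrite gt_eqF.
move=> i; apply: (mulIf (lt0r_neq0 (x0 i))).
rewrite (tapp_AalphaT_mul k_gt0 Ek) -mulrA -exprSr prednK// -(Blam i) mulr_suml.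
apply: eq_bigr => e /andP[eE ie]; rewrite [RHS]mulrDl -[in RHS]mulrA; congr (_ + _ * _).
have Te : 0 < T e by rewrite -(XT e i eE ie) mulr_gt0 ?B_gt0.
rewrite xk mulrC (XT e i eE ie); apply/eqP.
rewrite -(eqrXn2 k_gt0) ?(ltW Te) ?prodr_ge0// => [|j _]; last exact: ltW.
rewrite -prodrXl; apply/eqP; rewrite -[LHS]mulr1 -[X in _ * X](B1 e eE) -big_split /=.
rewrite (eq_bigr (fun=> T e)) => [|j je]; last by rewrite xk XT.
by rewrite prodr_const Ek.
Qed.

End Weights.

(** * Weights on a hypertree containing a path *)

Definition edge_path (V : finType) (E : {set {set V}}) (d : nat)
    (vv : nat -> V) (ee : nat -> {set V}) : Prop :=
  [/\ forall i, (i < d)%N -> [/\ ee i \in E, vv i \in ee i & vv i.+1 \in ee i],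
      forall i j, (i < j <= d)%N -> vv i != vv j
    & forall i j, (i < j < d)%N -> ee i != ee j].

Section PathRooting.
Variables (V : finType) (E : {set {set V}}).
Hypotheses (conn : connected E) (acyclic : forall v0 st, ~~ is_cycle E v0 st).
Hypothesis edge_neq0 : forall e, e \in E -> e != set0.
Variables (d s : nat) (vv : nat -> V) (ee : nat -> {set V}).
Hypotheses (sd : (s <= d)%N) (vvee : edge_path E d vv ee).

Definition path_root i := if (i < s)%N then vv i.+1 else vv i.

Lemma path_rooting : exists r p rk, rooted E E [set: V] (vv s) r p rk /\
  forall i, (i < d)%N -> r (ee i) = path_root i.
Proof.
have [inc vinj einj] := vvee.
(* The involution [sg] lists the path edges outwards from [vv s]: first [s - 1] down to 0, then [s]
   up to [d - 1]. Each of them is then attached at the centre or to an earlier edge. *)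
pose sg i := if (i < s)%N then (s.-1 - i)%N else i.
have sgd i : (i < d)%N -> (sg i < d)%N by rewrite /sg; case: ifP; lia.
have sginv i : sg (sg i) = i by rewrite /sg; case: (ltnP i s) => h; case: ifP; lia.
have [|||r [p [rk [rt rE]]]] := @rooting V E acyclic conn edge_neq0 (vv s) d
    (fun i => ee (sg i)) (fun i => path_root (sg i)).
- move=> i /sgd id; have [-> h1 h2] := inc _ id; split=> //.
  by rewrite /path_root; case: ifP.
- move=> i j /andP[ij jd]; apply: contraTneq isT => eij.
  have [lt|lt|eq] := ltngtP (sg i) (sg j).
  + by have := einj _ _ (_ : (sg i < sg j < d)%N); rewrite eij eqxx lt sgd// => /(_ isT).
  + have := einj _ _ (_ : (sg j < sg i < d)%N); rewrite eij eqxx lt sgd ?(ltn_trans ij)//.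
    by move=> /(_ isT).
  + by move: ij; rewrite -(sginv i) eq sginv ltnn.
- move=> [|i] id.
    left; rewrite /path_root /sg; case: (ltnP 0 s) => h.
      by rewrite subn0 prednK// leqnn.
    by case: s h.
  rewrite /path_root /sg; case: (ltnP i.+1 s) => h.
    right; exists i; rewrite // (ltnW h) ifT; last by lia.
    have -> : (s.-1 - i.+1).+1 = (s.-1 - i)%N by lia.
    by have [] := inc (s.-1 - i)%N; lia.
  rewrite ltnNge h /=; case: (ltngtP s i.+1) => h'; [|lia|by left; rewrite h'].
  right; exists i; rewrite // ifF; last by lia.
  by have [] := inc i; lia.
exists r, p, rk; split=> // i /sgd/rE; by rewrite sginv.
Qed.

End PathRooting.

Section TreeWeights.
Variables (V : finType) (E : {set {set V}}) (q : nat).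
Hypotheses (conn : connected E) (acyclic : forall v0 st, ~~ is_cycle E v0 st).
Hypothesis Ek : uniform E q.+2.
Variables (d s : nat) (vv : nat -> V) (ee : nat -> {set V}).
Hypotheses (s_gt0 : (0 < s)%N) (sd : (s <= d - s <= s.+1)%N).
Hypothesis vvee : edge_path E d vv ee.
Variables (R : rcfType) (alpha L : R).
Hypotheses (alpha_ge0 : 0 <= alpha) (alpha_lt1 : alpha < 1).
Let t := (d - s)%N.
Let M := (#|E| - d)%N.
Let cst := (1 - alpha) ^+ q.+2.
Local Notation w := (level q alpha cst L).
Hypothesis adm : admissible q alpha cst L t.
Hypothesis balance : L + alpha = w s + w t + M%:R * w 1%N.

Let cst_gt0 : 0 < cst. Proof. by rewrite exprn_gt0 ?subr_gt0. Qed.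
Let st : (0 < s <= t)%N. Proof. by rewrite s_gt0; case/andP: sd. Qed.
Let ts : (t <= s.+1)%N. Proof. by case/andP: sd. Qed.

Definition off_path (e : {set V}) : bool := ~~ [exists i : 'I_d, ee i == e].

Lemma off_pathP e : reflect (forall i, (i < d)%N -> e <> ee i) (off_path e).
Proof.
apply: (iffP existsPn) => h i; last by apply/eqP => /esym/(h _ (ltn_ord i)).
by move=> id /esym/eqP; apply/negP/(h (Ordinal id)).
Qed.

Let ee_inj i j : (i < d)%N -> (j < d)%N -> ee i = ee j -> i = j.
Proof.
move=> id jd; have [_ _ einj] := vvee.
case: (ltngtP i j) => // ij; first by have := einj i j; rewrite ij jd => /(_ isT)/eqP h /h.
by have := einj j i; rewrite ij id => /(_ isT)/eqP h /esym/h.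
Qed.

Let vv_inj i j : (i <= d)%N -> (j <= d)%N -> vv i = vv j -> i = j.
Proof.
move=> id jd; have [_ vinj _] := vvee.
case: (ltngtP i j) => // ij; first by have := vinj i j; rewrite ij jd => /(_ isT)/eqP h /h.
by have := vinj j i; rewrite ij id => /(_ isT)/eqP h /esym/h.
Qed.

Lemma off_path_neq e (i : 'I_d) : off_path e -> (ee i == e) = false.
Proof. by move=> /existsPn/(_ i)/negbTE. Qed.

Lemma sum_off_path : (\sum_(e in E) off_path e = M)%N.
Proof.
have [inc _ _] := vvee.
rewrite -big_mkcondr sum1_card /M.
pose P := [set ee (i : 'I_d) | i : 'I_d].
have PE : P \subset E by apply/subsetP => _ /imsetP[i _ ->]; have [] := inc i.
have <- : #|P| = d.
  by rewrite card_imset ?card_ord// => i j /ee_inj e; apply/val_inj/e.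
rewrite -cardsDS//; apply: eq_card => e; rewrite in_setD andbC unfold_in; congr (_ && ~~ _).
apply/existsP/imsetP => [[i /eqP <-]|[i _ ->]]; first by exists i.
by exists i.
Qed.

(* [pos i] is the number of edges of the path from the edge [ee i], included, to the end on its side. *)
Let pos i := if (i < s)%N then i.+1 else (d - i)%N.
Let root i := path_root s vv i.

Section Rooted.
Variables (r : {set V} -> V) (p : V -> {set V}) (rk : V -> nat) (x : V -> nat).
Hypothesis rt : rooted E E [set: V] (vv s) r p rk.
Hypothesis rE : forall i, (i < d)%N -> r (ee i) = root i.
Hypothesis xE : forall u,
  x u = (\sum_(e in E | r e == u) (off_path e + \sum_(v in e :\ r e) x v))%N.
Local Notation bel := (below r x).

(* [Wv e] is the load of the edge [e] at its root, [Wu u] the total load of the edges rooted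
   at [u], and [ht e] the number of path edges in the branch of [e] strictly below [e]. *)
Let Wv e : R := \sum_(i < d | ee i == e) w (pos i) + (off_path e + bel e)%:R * w 1%N.
Let Wu u : R := \sum_(e in E | r e == u) Wv e.
Let ht e : nat := (\sum_(i < d | ee i == e) (pos i).-1)%N.

Let d_gt : (s < d)%N. Proof. by move: sd s_gt0; lia. Qed.

Lemma vertex_load_eq u :
  Wu u = \sum_(i < d | root i == u) w (pos i) + (x u)%:R * w 1%N.
Proof.
have [inc _ _] := vvee.
rewrite /Wu big_split /= xE natr_sum mulr_suml; congr (_ + _).
rewrite (exchange_big_dep (fun i : 'I_d => root i == u)) /=; last first.
  by move=> e i /andP[_ /eqP <-] /eqP <-; rewrite rE.
apply: eq_bigr => i /eqP ri; rewrite (big_pred1 (ee i)) // => e /=.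
rewrite [in RHS]eq_sym; case: (ee i =P e) => [<-|]; last by rewrite andbF.
by have [-> _ _] := inc i (ltn_ord i); rewrite rE// ri eqxx.
Qed.

(** A vertex has only one parent, and the parent of the root of a path edge is the neighbouring path
    edge towards the centre. *)
Lemma path_root_child e (i : 'I_d) : e \in E -> root i \in e :\ r e ->
  [\/ (i.+1 < s)%N /\ e = ee i.+1 | (s < i)%N /\ e = ee i.-1].
Proof.
have [inc _ _] := vvee; have id := ltn_ord i.
move=> eE; rewrite !inE => /andP[vr ve].
have [vc pe] := rooted_child rt eE ve vr; move: vr ve vc pe; rewrite /root /path_root.
case: (ltnP i s) => is_ vr ve vc pe.
  have is1 : (i.+1 < s)%N.
    by rewrite ltn_neqAle is_ andbT; apply: contraNneq vc => ->.
  have id1 : (i.+1 < d)%N by lia.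
  left; split=> //; rewrite -pe; have [fE fv _] := inc _ id1.
  apply: (rooted_child rt fE fv _).2; rewrite rE// /root /path_root is1.
  by apply/eqP => /vv_inj h; have := h _ _; lia.
have is1 : (s < i)%N.
  by rewrite ltn_neqAle is_ andbT; apply: contraNneq vc => ->.
have id1 : (i.-1 < d)%N by lia.
right; split=> //; rewrite -pe; have [fE _ fv] := inc _ id1.
rewrite prednK ?(leq_ltn_trans _ is1)// in fv.
apply: (rooted_child rt fE fv _).2; rewrite rE// /root /path_root ifF; last by lia.
by apply/eqP => /vv_inj h; have := h _ _; lia.
Qed.

(** Only the next path edge outwards is rooted at a child of [ee j]. At an end of the path there is
    none, which agrees with [w 0 = 0]. *)
Lemma sum_path_children j : (j < d)%N ->
  \sum_(i < d | root i \in ee j :\ r (ee j)) w (pos i) = w (pos j).-1.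
Proof.
move=> jd; have [inc _ _] := vvee; have [jE jv jv1] := inc j jd.
case: (ltnP j s) => js.
  have eqi (i : 'I_d) : (root i \in ee j :\ r (ee j)) = (i.+1 == j).
    apply/idP/eqP => [/(path_root_child jE)|ij].
      by have id := ltn_ord i; case=> [[i1 /ee_inj h]|[i1 /ee_inj h]]; have := h _ _; lia.
    rewrite rE// !inE /root /path_root js ifT ?ij ?jv ?andbT; last by lia.
    by apply/eqP => /vv_inj h; have := h _ _; lia.
  rewrite (eq_bigl _ _ eqi) /pos js /=; case: j jd {jE jv jv1 eqi} js => [|j] jd js.
    by rewrite big_pred0.
  rewrite (big_pred1 (Ordinal (ltnW jd))) => [|i]; last by rewrite eqSS.
  by rewrite /= ltnW.
have eqi (i : 'I_d) : (root i \in ee j :\ r (ee j)) = (i == j.+1 :> nat).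
  apply/idP/eqP => [/(path_root_child jE)|ij].
    by have id := ltn_ord i; case=> [[i1 /ee_inj h]|[i1 /ee_inj h]]; have := h _ _; lia.
  rewrite rE// !inE /root /path_root ij ifF ?ifF ?jv1 ?andbT; try lia.
  by apply/eqP => /vv_inj h; have := h _ _; have := ltn_ord i; lia.
rewrite (eq_bigl _ _ eqi) /pos [in RHS]ifF; last by lia.
case: (ltnP j.+1 d) => j1d.
  rewrite (big_pred1 (Ordinal j1d))//= ifF; last by lia.
  by rewrite subnS.
have -> : (d - j).-1 = 0%N by lia.
by rewrite big_pred0// => i; have := ltn_ord i; lia.
Qed.

Lemma path_or_off e : (exists2 j, (j < d)%N & e = ee j) \/ off_path e.
Proof.
have [|] := boolP (off_path e); first by right.
by rewrite negbK => /existsP[i /eqP <-]; left; exists i.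
Qed.

Lemma height_path j : (j < d)%N -> ht (ee j) = (pos j).-1.
Proof.
move=> jd; rewrite /ht (big_pred1 (Ordinal jd))// => i.
by apply/eqP/eqP => [/ee_inj h|->//]; apply/val_inj/h.
Qed.

Lemma path_height_lt j : (j < d)%N -> (0 < pos j <= t)%N.
Proof. by move=> jd; rewrite /pos /t; case: ifP; move: sd; lia. Qed.

Lemma off_path_ee j : (j < d)%N -> off_path (ee j) = false.
Proof. by move=> jd; apply/negbF/existsP; exists (Ordinal jd). Qed.

(** An off-path edge counts as the last edge of a path: its own contribution [w 1] is the level
    above height 0. All edges thus get the form required by [balance_edge]. *)
Lemma edge_load_eq e : Wv e = w (ht e).+1 + (bel e)%:R * w 1%N.
Proof.
rewrite /Wv; case: (path_or_off e) => [[j jd ->]|offe].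
  rewrite height_path// prednK; last by case/andP: (path_height_lt jd).
  rewrite (big_pred1 (Ordinal jd)) ?off_path_ee// => i.
  by apply/eqP/eqP => [/ee_inj h|->//]; apply/val_inj/h.
have ne (i : 'I_d) := off_path_neq i offe.
rewrite /ht !big_pred0// offe add0r natrD mulrDl mul1r; congr (_ + _).
Qed.

Lemma height_lt e : (ht e < t)%N.
Proof.
case: (path_or_off e) => [[j jd ->]|offe].
  by rewrite height_path//; have := path_height_lt jd; lia.
rewrite /ht big_pred0; first by move: sd s_gt0; rewrite /t; lia.
by move=> i; apply: off_path_neq.
Qed.

Lemma children_load_eq e : e \in E ->
  \sum_(u in e :\ r e) Wu u = w (ht e) + (bel e)%:R * w 1%N.
Proof.
move=> eE; rewrite (eq_bigr _ (fun u _ => vertex_load_eq u)) big_split /=.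
rewrite -mulr_suml -natr_sum; congr (_ + _).
rewrite (exchange_big_dep (fun i : 'I_d => root i \in e :\ r e)) /=; last first.
  by move=> u i ue /eqP->.
have -> : \sum_(i < d | root i \in e :\ r e) \sum_(u in e :\ r e | root i == u) w (pos i) =
    \sum_(i < d | root i \in e :\ r e) w (pos i).
  apply: eq_bigr => i ie; rewrite (big_pred1 (root i))// => u /=.
  by rewrite eq_sym; case: eqP => [->|]; rewrite ?andbF// ie.
case: (path_or_off e) => [[j jd eE']|offe].
  by rewrite eE' height_path// sum_path_children.
have ne (i : 'I_d) := off_path_neq i offe.
rewrite /ht !big_pred0// => i; apply/negP => /(path_root_child eE); have id := ltn_ord i.
by case=> [[i1]|[i1]]; move/off_pathP: offe; apply; lia.
Qed.

(** The path edges rooted at the centre are [ee s.-1] and [ee s], with levels [s] and [t], and all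
    [M] off-path edges are counted there. *)
Lemma center_load_eq : Wu (vv s) = L + alpha.
Proof.
rewrite vertex_load_eq (load_center rt xE) sum_off_path balance; congr (_ + _).
have s1d : (s.-1 < d)%N by lia.
rewrite (bigD1 (Ordinal s1d)) /=; last first.
  by rewrite /root /path_root ifT ?prednK ?eqxx//; lia.
rewrite (bigD1 (Ordinal d_gt)) /=; last first.
  rewrite /root /path_root ifF ?eqxx /=; last by lia.
  by apply/eqP => /(congr1 val) /=; lia.
rewrite big1 ?addr0; last first.
  move=> i /andP[/andP[ri]]; rewrite -!val_eqE /= => i1 i2.
  have id := ltn_ord i; move: ri; rewrite /root /path_root.
  by case: ifP => h /eqP /vv_inj h'; have := h' _ _; lia.
by rewrite /pos ifT ?ifF ?prednK//; lia.
Qed.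

(* Away from the root, the load of [e] at [u] is [lam - Wu u], which makes every vertex sum
   except that of the centre equal to [lam] by construction. *)
Let wt u e : R := if u == r e then (Wv e - alpha) / (1 - alpha) else (L - Wu u) / (1 - alpha).

Let g_gt0 : 0 < 1 - alpha. Proof. by rewrite subr_gt0. Qed.
Let w1_gt0 : 0 < w 1%N. Proof. exact (level1_gt0 alpha_ge0 cst_gt0 st adm). Qed.
Let L_gt0 : 0 < L. Proof. exact: balance_gt0 st adm. Qed.
Let bel_le e : e \in E -> (bel e <= M)%N.
Proof. by move=> eE; rewrite -sum_off_path; exact (below_le rt xE eE). Qed.

Lemma vertex_load_ge0 u : 0 <= Wu u.
Proof.
apply: sumr_ge0 => e _; rewrite edge_load_eq addr_ge0 ?mulr_ge0 ?ler0n ?(ltW w1_gt0)//.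
by apply/ltW/(le_lt_trans alpha_ge0)/(level_gt_alpha cst_gt0 st adm (height_lt e)).
Qed.

Lemma children_load_lt e : e \in E -> \sum_(u in e :\ r e) Wu u < L.
Proof.
move=> eE; rewrite children_load_eq//.
exact (level_load_lt alpha_ge0 cst_gt0 st ts adm balance (height_lt e) (bel_le eE)).
Qed.

Lemma vertex_load_lt e u : e \in E -> u \in e :\ r e -> Wu u < L.
Proof.
move=> eE ue; apply: le_lt_trans (children_load_lt eE).
by rewrite (bigD1 u ue) /= lerDl sumr_ge0// => v _; exact: vertex_load_ge0.
Qed.

Lemma edge_load_gt e : alpha < Wv e.
Proof.
rewrite edge_load_eq; apply: (lt_le_trans (level_gt_alpha cst_gt0 st adm (height_lt e))).
by rewrite lerDl mulr_ge0 ?ler0n// ltW.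
Qed.

Lemma weight_gt0 e u : e \in E -> u \in e -> 0 < wt u e.
Proof.
move=> eE ue; rewrite /wt; case: eqP => [_|/eqP ur]; rewrite divr_gt0// subr_gt0.
  exact: edge_load_gt.
by apply: (vertex_load_lt eE); rewrite !inE ur.
Qed.

Lemma weight_sum u :
  \sum_(e in E | u \in e) (alpha + (1 - alpha) * wt u e) = L + alpha.
Proof.
have wE e : alpha + (1 - alpha) * wt u e = if u == r e then Wv e else L + alpha - Wu u.
  by rewrite /wt; case: eqP => _; rewrite mulrC divfK ?gt_eqF//; ring.
under eq_bigr do rewrite wE.
rewrite (bigID (fun e => r e == u)) /=.
have -> : \sum_(e | (e \in E) && (u \in e) && (r e == u)) (if u == r e then Wv e else L + alpha - Wu u) = Wu u.
  rewrite /Wu; apply: eq_big => [e|e /andP[_ /eqP->]]; last by rewrite eqxx.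
  case eE: (e \in E) => //=; case: eqP => [<-|]; last by rewrite andbF.
  by rewrite (rooted_root rt eE).
have [->|uc] := eqVneq u (vv s).
  rewrite big1 ?addr0 ?center_load_eq// => e /andP[/andP[eE ce]]; rewrite eq_sym => cr.
  by have [] := rooted_child rt eE ce cr; rewrite eqxx.
have [pE up ur] := rooted_parent rt (in_setT u) uc.
rewrite (big_pred1 (p u)) => [|e]; first by rewrite (negPf ur); ring.
apply/idP/eqP => [/andP[/andP[eE ue]]|->]; last by rewrite pE up eq_sym ur.
by rewrite eq_sym => ure; rewrite (rooted_child rt eE ue ure).2.
Qed.

(** Up to the factor [cst], the product is bounded below first by the product inequality over the
    children and then by [balance_edge]. A product equal to 1 forces equality in both. *)
Lemma weight_prod e : e \in E ->
  1 <= \prod_(u in e) wt u e /\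
  (\prod_(u in e) wt u e = 1 ->
   L * \prod_(u in e :\ r e) (L - Wu u) =
     L ^+ q.+1 * (L - \sum_(u in e :\ r e) Wu u) /\
   (bel e = 0%N \/ [/\ bel e = M, ht e = s & t = s.+1])).
Proof.
move=> eE; have re := rooted_root rt eE.
have card_e : #|e :\ r e| = q.+1.
  by have := cardsD1 (r e) e; rewrite re (Ek eE) => -[].
set Y := \sum_(u in e :\ r e) Wu u; set P := \prod_(u in e :\ r e) (L - Wu u).
have prodE : \prod_(u in e) wt u e = (Wv e - alpha) * P / cst.
  rewrite (big_setD1 (r e) re) /= /wt eqxx.
  rewrite (eq_bigr (fun u => (L - Wu u) / (1 - alpha))) => [|u]; last first.
    by rewrite !inE => /andP[/negPf->].
  rewrite big_split /= prodr_const card_e exprVn mulf_div; congr (_ / _).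
have YL : Y < L := children_load_lt eE.
have := ler_prod_sub (ltW L_gt0) (fun u (_ : u \in e :\ r e) => vertex_load_ge0 u) (ltW YL).
rewrite card_e -/Y -/P => PY.
have Lq : 0 < L ^+ q by rewrite exprn_gt0.
have {}PY : L ^+ q * (L - Y) <= P.
  by rewrite -(ler_pM2l L_gt0) mulrA -exprS.
have We := edge_load_gt e.
have [] := balance_edge alpha_ge0 cst_gt0 st ts adm balance (height_lt e) (bel_le eE).
rewrite -edge_load_eq -children_load_eq// -/Y => le1 eq1.
have le2 : (Wv e - alpha) * (L ^+ q * (L - Y)) <= (Wv e - alpha) * P.
  by rewrite ler_pM2l// subr_gt0.
rewrite prodE ler_pdivlMr// mul1r; split; first exact: le_trans le2.
move=> /(canRL (divfK (lt0r_neq0 cst_gt0))); rewrite mul1r => e1.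
have e2 : (Wv e - alpha) * (L ^+ q * (L - Y)) = cst.
  by apply/eqP; rewrite eq_le le1 -e1 le2.
split; last exact (eq1 (esym e2)).
move: e1; rewrite -e2 => /mulfI ->; last by rewrite subr_eq0 gt_eqF.
by rewrite mulrA -exprS.
Qed.

(* An off-path edge whose root is not the centre sits below an edge with [bel > 0], and the
   only such edge can be the middle one, when [d] is odd. *)
Lemma tight_weights : (forall e, e \in E -> \prod_(u in e) wt u e = 1) ->
  (forall e, e \in E -> off_path e -> vv s \in e) \/
  (forall e, e \in E -> off_path e -> vv t \in e).
Proof.
move=> tight; have T e (eE : e \in E) := (weight_prod eE).2 (tight e eE).
have x_root e : e \in E -> off_path e -> (0 < x (r e))%N.
  move=> eE offe; apply: leq_trans (load_edge_le xE eE); by rewrite offe.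
have parent_bel e : e \in E -> off_path e -> r e != vv s ->
    [/\ p (r e) \in E, r e \in p (r e) :\ r (p (r e)) & (0 < bel (p (r e)))%N].
  move=> eE offe rc; have [pE up ur] := rooted_parent rt (in_setT (r e)) rc.
  have h : r e \in p (r e) :\ r (p (r e)) by rewrite !inE ur.
  split=> //; rewrite /below (bigD1 _ h) /=.
  exact: leq_trans (x_root e eE offe) (leq_addr _ _).
have [/existsP[e0 /andP[eE0 be0]]|none] := boolP [exists e, (e \in E) && (0 < bel e)%N]; last first.
  left=> e eE offe; have [<-|rc] := eqVneq (r e) (vv s); first exact: (rooted_root rt).
  have [pE _ bp] := parent_bel e eE offe rc.
  by case/existsP: none; exists (p (r e)); rewrite pE.
(* Height [s] singles out [ee s]: off the path the height is 0, the path edge [j < s] has height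
   [j], and beyond the centre [t = s.+1] leaves only [j = s]. *)
have exc e : e \in E -> (0 < bel e)%N -> [/\ e = ee s, bel e = M & t = s.+1].
  move=> eE be; have [_ []] := T e eE; first by move=> b0; rewrite b0 in be.
  move=> [bM hs tE]; split=> //; case: (path_or_off e) => [[j jd ej]|offe].
    rewrite ej height_path// /pos in hs; rewrite ej; congr ee.
    by clear -hs jd tE; move: tE; rewrite /t; case: ltnP hs; lia.
  by move: hs; rewrite /ht big_pred0 => [|i]; [move: s_gt0; case: s|apply: off_path_neq].
have [e0E be0M tE] := exc e0 eE0 be0; subst e0.
right=> e eE offe.
have rs : r (ee s) = vv s by rewrite rE// /root /path_root ltnn.
have rc : r e != vv s.
  (* The count at the centre is [M], which the branch below [ee s] already exhausts; [e] rooted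
     there would add one more. *)
  apply/eqP => rc; have := sum_off_path; rewrite -(load_center rt xE) xE.
  rewrite (bigD1 (ee s)) /=; last by rewrite eE0 rs eqxx.
  rewrite (bigD1 e) /=; last first.
    by rewrite eE rc eqxx; apply/eqP => es; rewrite es off_path_ee in offe.
  rewrite -/(bel (ee s)) offe be0M => /eqP.
  by rewrite -addnA addnCA -[X in _ == X]addn0 eqn_add2l !addn_eq0 andbF.
have [pE rp bp] := parent_bel e eE offe rc.
have [pe _ _] := exc _ pE bp; rewrite pe in rp.
have vt : vv t \in ee s :\ r (ee s).
  have [inc vinj _] := vvee; have [_ _ h] := inc s d_gt.
  by rewrite !inE rs tE h andbT eq_sym vinj// ltnSn d_gt.
have Wt : 0 < Wu (vv t).
  rewrite vertex_load_eq ltr_wpDr ?mulr_ge0 ?ler0n ?(ltW w1_gt0)//.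
  have sd1 : (s.+1 < d)%N by clear -tE s_gt0; move: tE; rewrite /t; lia.
  rewrite (bigD1 (Ordinal sd1)) /=; last first.
    by rewrite /root /path_root ltnNge leqnSn /= tE eqxx.
  rewrite ltr_pwDl ?sumr_ge0//.
    rewrite /pos ltnNge leqnSn /=.
    have : (0 < d - s.+1 <= t)%N by clear -sd1; rewrite /t; lia.
    case: (d - s.+1)%N => // j /andP[_ jt].
    exact (le_lt_trans alpha_ge0 (level_gt_alpha cst_gt0 st adm jt)).
  move=> i _; have /andP[p0 pt] := path_height_lt (ltn_ord i).
  rewrite -(prednK p0); apply: ltW; apply: le_lt_trans alpha_ge0 _.
  by apply: (level_gt_alpha cst_gt0 st adm); rewrite prednK.
have [eqP_ _] := T _ eE0.
have card_e : #|ee s :\ r (ee s)| = q.+1.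
  by have := cardsD1 (r (ee s)) (ee s); rewrite (rooted_root rt eE0) (Ek eE0) => -[].
rewrite -card_e in eqP_.
(* Tightness at [ee s] lets only one child carry a nonzero load. This is [vv t], where the path
   continues, and [e] puts a nonzero load on its root. *)
have zero := eq_prod_sub L_gt0 (fun u (_ : u \in ee s :\ r (ee s)) => vertex_load_ge0 u)
  (ltW (children_load_lt eE0)) eqP_ vt Wt.
have [<-|rt_neq] := eqVneq (r e) (vv t); first exact: (rooted_root rt).
have /eqP := zero _ rp rt_neq; rewrite /Wu (bigD1 e) ?eE ?eqxx//= gt_eqF//.
rewrite ltr_pwDl ?sumr_ge0//; first exact (le_lt_trans alpha_ge0 (edge_load_gt e)).
by move=> f _; apply/ltW; exact (le_lt_trans alpha_ge0 (edge_load_gt f)).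
Qed.

End Rooted.

Lemma tree_weights : exists B : V -> {set V} -> R,
  [/\ forall e i, e \in E -> i \in e -> 0 < B i e,
      forall i, \sum_(e in E | i \in e) (alpha + (1 - alpha) * B i e) = L + alpha,
      forall e, e \in E -> 1 <= \prod_(i in e) B i e &
      (forall e, e \in E -> \prod_(i in e) B i e = 1) ->
      (forall e, e \in E -> off_path e -> vv s \in e) \/
      (forall e, e \in E -> off_path e -> vv t \in e)].
Proof.
have E0 e : e \in E -> e != set0 by move=> eE; rewrite -card_gt0 Ek.
have sd' : (s <= d)%N by move: sd; lia.
have [r [p [rk [rt rE]]]] := path_rooting conn acyclic E0 sd' vvee.
have [x xE] := load_exists rt (fun e => off_path e : nat).
eexists; split; last exact (tight_weights rt rE xE).
- exact (weight_gt0 rt rE xE).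
- exact (weight_sum rt rE xE).
- by move=> e eE; case: (weight_prod rt rE xE eE).
Qed.

End TreeWeights.

(** * Weights on [S_{m,d,k}] *)

Section SpiderEdges.
Variables (m d q : nat).
Hypotheses (d_gt1 : (1 < d)%N) (dm : (d <= m)%N).
Local Notation k := q.+2.
Local Notation s := (d./2).
Local Notation SV := (SV m k).

Definition root_index j := if (j < d)%N then j else s.

Lemma SrootE j : Sroot d k j = (root_index j * q.+1)%N.
Proof. by rewrite /Sroot /root_index; case: ifP. Qed.

Lemma root_index_le j : (0 < j)%N -> (0 < root_index j <= j)%N.
Proof. clear dm; by rewrite /root_index; case: ifP; lia. Qed.

Lemma root_index_lt j : (root_index j < d)%N.
Proof. clear dm; by rewrite /root_index; case: ifP; lia. Qed.

Definition root_vertex j : SV := inord (Sroot d k j).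
Definition block_vertex j (i : 'I_q.+1) : SV := inord (j * q.+1 + i.+1).

Lemma root_vertexE j : root_vertex j = Sroot d k j :> nat.
Proof.
rewrite /root_vertex inordK// SrootE ltnS leq_mul2r; apply/orP; right.
by have := root_index_lt j; lia.
Qed.

Lemma block_vertexE j i : (j < m)%N -> block_vertex j i = (j * q.+1 + i.+1)%N :> nat.
Proof.
move=> jm; clear d_gt1 dm; rewrite /block_vertex inordK// ltnS.
have : (j.+1 * q.+1 <= m * q.+1)%N by rewrite leq_mul2r jm orbT.
by rewrite mulSn; have := ltn_ord i; rewrite /=; lia.
Qed.

Lemma in_block j (v : nat) : ((j * q.+1 < v) && (v <= j.+1 * q.+1))%N =
  (0 < v)%N && (v.-1 %/ q.+1 == j)%N.
Proof.
case: v => [|v] //=.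
by rewrite ltnS -leq_divRL// -ltn_divLR// ltnS -eqn_leq eq_sym.
Qed.

Lemma in_Sedge j (v : SV) : (v \in Sedge m d k j) =
  (v == Sroot d k j :> nat) || (0 < v)%N && (v.-1 %/ q.+1 == j)%N.
Proof. by rewrite inE in_block. Qed.

Lemma Sroot_notin_block j v : v = Sroot d k j -> ~~ ((0 < v)%N && (v.-1 %/ q.+1 == j)%N).
Proof.
clear dm; move=> ->; rewrite -in_block SrootE ltn_mul2r /=; apply/negP => /andP[+ _].
by rewrite /root_index; case: ifP; lia.
Qed.

Lemma SedgeE j : (j < m)%N ->
  Sedge m d k j = root_vertex j |: [set block_vertex j i | i : 'I_q.+1].
Proof.
move=> jm; apply/setP => v; rewrite !inE -val_eqE /= root_vertexE; congr (_ || _).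
apply/andP/imsetP => [[v1 v2]|[i _ ->]]; last first.
  by rewrite block_vertexE//; have := ltn_ord i; rewrite mulSn; split; lia.
have vi : (v - (j * q.+1).+1 < q.+1)%N by move: v2; rewrite mulSn /=; lia.
by exists (Ordinal vi) => //; apply/val_inj; rewrite /= block_vertexE//=; lia.
Qed.

Lemma block_vertex_inj j : (j < m)%N -> injective (block_vertex j).
Proof.
move=> jm a b /(congr1 val); rewrite /= !block_vertexE// => /eqP.
by rewrite eqn_add2l eqSS => /eqP/val_inj.
Qed.

Lemma root_vertex_notin j : (j < m)%N ->
  root_vertex j \notin [set block_vertex j i | i : 'I_q.+1].
Proof.
move=> jm; apply/imsetP => -[i _ /(congr1 val)]; rewrite /= root_vertexE => e.
have := Sroot_notin_block (esym e); rewrite block_vertexE// addnS /=.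
by rewrite divnMDl// divn_small// addn0 eqxx.
Qed.

Lemma big_Sedge (T : Type) (idx : T) (op : Monoid.com_law idx) (F : SV -> T) j :
  (j < m)%N -> \big[op/idx]_(v in Sedge m d k j) F v =
  op (F (root_vertex j)) (\big[op/idx]_(i < q.+1) F (block_vertex j i)).
Proof.
move=> jm; rewrite SedgeE// big_setU1 ?root_vertex_notin//=.
by rewrite big_imset//= => a b _ _; apply: block_vertex_inj.
Qed.

Lemma card_Sedge j : (j < m)%N -> #|Sedge m d k j| = k.
Proof.
move=> jm; rewrite SedgeE// cardsU1 root_vertex_notin// card_imset ?card_ord//.
exact: block_vertex_inj.
Qed.

Lemma Sedge_inj i j : (i < m)%N -> (j < m)%N -> Sedge m d k i = Sedge m d k j -> i = j.
Proof.
wlog ij : i j / (i <= j)%N => [hwlog|] im jm e.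
  by case/orP: (leq_total i j) => h; [apply: hwlog|apply/esym/hwlog].
have : block_vertex j ord_max \in Sedge m d k i.
  by rewrite e SedgeE// !inE imset_f ?orbT.
rewrite in_Sedge block_vertexE// addnS /= divnMDl// divn_small// addn0 eq_sym.
case/orP => [|/eqP//]; rewrite SrootE => /eqP h.
have : (root_index i <= i)%N.
  by case: i {ij im e h} => [|i]; [rewrite /root_index ifT//; lia|case/andP: (@root_index_le i.+1 isT)].
move=> ri; have : (root_index i * q.+1 <= j * q.+1)%N by rewrite leq_mul2r (leq_trans ri) ?orbT.
by rewrite h /=; lia.
Qed.

Lemma uniform_SE : uniform (SE m d k) k.
Proof. by move=> e /imsetP[j _ ->]; apply: card_Sedge. Qed.

Lemma big_SE (T : Type) (idx : T) (op : Monoid.com_law idx) (F : {set SV} -> T) v :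
  \big[op/idx]_(e in SE m d k | v \in e) F e =
  \big[op/idx]_(j < m | v \in Sedge m d k j) F (Sedge m d k j).
Proof.
rewrite /SE -big_filter_cond big_filter_cond.
rewrite big_mkcondr big_imset /=; last by move=> i j _ _ /Sedge_inj e; apply/val_inj/e.
by rewrite -big_mkcondr.
Qed.

End SpiderEdges.

Section SpiderWeights.
Variables (m d q : nat).
Hypotheses (d_gt1 : (1 < d)%N) (dm : (d <= m)%N).
Local Notation k := q.+2.
Local Notation s := (d./2).
Local Notation SV := (SV m k).
Variables (R : rcfType) (alpha L : R).
Hypotheses (alpha_ge0 : 0 <= alpha) (alpha_lt1 : alpha < 1).
Let t := (d - s)%N.
Let cst := (1 - alpha) ^+ q.+2.
Local Notation w := (level q alpha cst L).
Hypothesis adm : admissible q alpha cst L t.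
Hypothesis balance : L + alpha = w s + w t + (m - d)%N%:R * w 1%N.

Let cst_gt0 : 0 < cst. Proof. by rewrite exprn_gt0 ?subr_gt0. Qed.
Let st : (0 < s <= t)%N. Proof. by rewrite /t; lia. Qed.
Let L_gt0 : 0 < L. Proof. exact: balance_gt0 st adm. Qed.

(** Loads of the edge [j] at its two distinguished vertices, [Sroot d k j] and the last vertex of
    its block. Towards the centre the load is a level, away from it [lam] minus the previous level.
    Left of the centre the last vertex is the inner one, elsewhere the root is. *)
Let root_load j :=
  if (j < s)%N then L + alpha - w j else if (j < d)%N then w (d - j) else w 1%N.
Let last_load j :=
  if (j < s)%N then w j.+1 else if (j < d)%N then L + alpha - w (d - j).-1 else L + alpha.
Let vertex_load (v j : nat) :=
  if v == Sroot d k j then root_load j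
  else if v == (j.+1 * q.+1)%N then last_load j else L + alpha.

Let w_gt j : (0 < j <= t)%N -> alpha < w j.
Proof. by case: j => // j /= jt; exact (level_gt_alpha cst_gt0 st adm jt). Qed.
Let w_lt j : (j < t)%N -> alpha < L + alpha - w j.
Proof. by move=> jt; have := adm jt; lra. Qed.

Let root_load_gt j : alpha < root_load j.
Proof.
rewrite /root_load; case: ifP => js; first by apply: w_lt; rewrite /t; lia.
by case: ifP => jd; apply: w_gt; rewrite /t; lia.
Qed.

Let last_load_gt j : alpha < last_load j.
Proof.
rewrite /last_load; case: ifP => js; first by apply: w_gt; rewrite /t; lia.
case: ifP => jd; first by apply: w_lt; rewrite /t; lia.
by have := L_gt0; lra.
Qed.

Let vertex_load_gt v j : alpha < vertex_load v j.
Proof. by rewrite /vertex_load; do 2?case: ifP => // _; have := L_gt0; lra. Qed.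

Let load_mul j : (root_load j - alpha) * (L ^+ q * (last_load j - alpha)) = cst.
Proof.
rewrite /root_load /last_load; case: ifP => js.
  have jt : (j < t)%N by rewrite /t; lia.
  by rewrite -[RHS](level_eqS st adm jt); ring.
case: ifP => jd.
  have jt : ((d - j).-1 < t)%N by rewrite /t; lia.
  by rewrite -[RHS](level_eqS st adm jt) prednK ?subn_gt0//; ring.
have t0 : (0 < t)%N by rewrite /t; lia.
by rewrite -[RHS](level_eqS st adm t0) [w 0]/=; ring.
Qed.

Let wt (v j : nat) := (vertex_load v j - alpha) / (1 - alpha).

Let wt_gt0 v j : 0 < wt v j.
Proof. by rewrite divr_gt0// subr_gt0. Qed.

Lemma spider_prod j : (j < m)%N -> \prod_(v in Sedge m d k j) wt v j = 1.
Proof.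
move=> jm; rewrite big_Sedge//= root_vertexE//.
have blockE (i : 'I_q.+1) : vertex_load (block_vertex m j i) j =
    if i == ord_max then last_load j else L + alpha.
  rewrite /vertex_load ifF; last first.
    apply/negbTE/eqP => /(Sroot_notin_block d_gt1).
    rewrite block_vertexE// addnS /= divnMDl// divn_small// addn0 eqxx//.
  by rewrite block_vertexE// mulSn addnC eqn_add2r eqSS.
under eq_bigr do rewrite /wt blockE.
rewrite big_ord_recr /= eqxx (eq_bigr (fun=> L / (1 - alpha))) => [|i _]; last first.
  by rewrite ifF ?addrK// -val_eqE /= ltn_eqF.
rewrite prodr_const card_ord /wt /vertex_load eqxx expr_div_n.
have g0 : 1 - alpha != 0 by rewrite subr_eq0 gt_eqF.
rewrite !mulf_div -[X in X / _ = _](_ : cst = _).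
  by rewrite -exprSr -exprS divff// expf_neq0.
by rewrite -(load_mul j).
Qed.

Lemma spider_sum (v : SV) :
  \sum_(j < m | v \in Sedge m d k j) vertex_load v j = L + alpha.
Proof.
have bal := balance.
under eq_bigl do rewrite in_Sedge.
rewrite (bigID (fun j : 'I_m => v == Sroot d k j :> nat)) /=.
have -> : \sum_(j < m | ((v == Sroot d k j :> nat) || (0 < v)%N && (v.-1 %/ q.+1 == j)%N) &&
    (v == Sroot d k j :> nat)) vertex_load v j =
    \sum_(j < m | (v == root_index d j * q.+1 :> nat)%N) root_load j.
  apply: eq_big => [j|j /andP[_ vj]]; last by rewrite /vertex_load vj.
  by rewrite SrootE; case: eqP; rewrite ?andbF.
have -> : \sum_(j < m | ((v == Sroot d k j :> nat) || (0 < v)%N && (v.-1 %/ q.+1 == j)%N) &&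
    ~~ (v == Sroot d k j :> nat)) vertex_load v j =
    \sum_(j < m | (0 < v)%N && (v.-1 %/ q.+1 == j)%N)
      (if v == (j.+1 * q.+1)%N :> nat then last_load j else L + alpha).
  apply: eq_big => [j|j /andP[_ /negbTE vj]]; last by rewrite /vertex_load vj.
  case: eqP => [/(Sroot_notin_block d_gt1)/negbTE->//|_]; by rewrite andbT.
have vm : (v <= m * q.+1)%N by have := ltn_ord v.
case: (posnP v) => [v0|vpos].
  rewrite [X in _ + X]big_pred0 ?addr0// v0.
  have m0 : (0 < m)%N by lia.
  rewrite (big_pred1 (Ordinal m0)) => [|j]; last first.
    rewrite /= eq_sym muln_eq0 orbF -val_eqE /= /root_index; case: ifP => //.
    by move=> jd; apply/eqP/eqP; lia.
  by rewrite /root_load ifT /= ?subr0//; lia.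
have jm : (v.-1 %/ q.+1 < m)%N by rewrite ltn_divLR// prednK.
rewrite [X in _ + X](big_pred1 (Ordinal jm)) => [|j]; last by rewrite eq_sym.
rewrite /=; case: (boolP (q.+1 %| v)%N) => [/dvdnP[a va]|ndv]; last first.
  rewrite big_pred0 ?add0r ?ifF//.
    by apply: contraNF ndv => /eqP->; rewrite dvdn_mull.
  by move=> j; apply: contraNF ndv => /eqP->; rewrite dvdn_mull.
have a0 : (0 < a)%N by move: vpos; rewrite va; case: a va.
have am : (a <= m)%N by move: vm; rewrite va leq_mul2r.
have -> : (v.-1 %/ q.+1 = a.-1)%N.
  rewrite va; case: a a0 {va am} => // a _.
  by rewrite mulSn addSn /= addnC divnMDl// divn_small// addn0.
rewrite prednK// va eqxx.
under eq_bigl do rewrite eqn_pmul2r//.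
have -> : \sum_(j < m | a == root_index d j) root_load j =
   (if (a < d)%N then root_load a else 0) + (if a == s then (m - d)%N%:R * w 1%N else 0).
  rewrite (bigID (fun j : 'I_m => (j < d)%N)) /=; congr (_ + _).
    case: ifP => ad; last first.
      rewrite big_pred0// => j; rewrite /root_index; case: ifP => jd; last by rewrite andbF.
      by rewrite andbT; apply/eqP; lia.
    have am' : (a < m)%N by lia.
    rewrite (big_pred1 (Ordinal am')) => [//|j]; rewrite /= /root_index -val_eqE /=.
    by rewrite [in RHS]eq_sym; case: ifP => jd; rewrite ?andbT ?andbF//; apply/esym/eqP; lia.
  case: ifP => as_; last first.
    rewrite big_pred0// => j; rewrite /root_index; case: ifP => jd; first by rewrite andbF.
    by rewrite as_.
  rewrite (eq_bigl (fun j : 'I_m => (d <= j)%N)) => [|j]; last first.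
    by rewrite /root_index; case: ltnP; rewrite ?andbT ?andbF.
  rewrite (eq_bigr (fun=> w 1%N)) => [|j dj]; last by rewrite /root_load ifF ?ifF//; lia.
  rewrite sumr_const mulr_natl; congr (_ *+ _).
  rewrite -sum1_card -(big_mkord (fun j => (d <= j)%N) (fun=> 1%N)).
  have <- : (\sum_(d <= j < m) 1 = m - d)%N by rewrite sum_nat_const_nat muln1.
  by rewrite [RHS](big_nat_widenl d 0).
rewrite /root_load /last_load.
(* At the multiple [a] of [q.+1], the load of the edge [a - 1] at its last vertex meets the loads of
   the edges rooted there. They complement each other along the path; at [a = s] the balance
   equation is used, at [a = d] that [w 0 = 0], and for [a > d] the vertex is the last one of a
   pendant edge. *)
case: (ltngtP a s) => as_.
- rewrite ifT ?ifT; [|lia..]. by rewrite prednK//; ring.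
- rewrite (_ : (a.-1 < s)%N = false); last by lia.
  case: (ltnP a d) => ad.
    by rewrite ifT; [have -> : (d - a.-1).-1 = (d - a)%N by lia|lia]; ring.
  case: ifP => ad'; last by ring.
  have -> : (d - a.-1).-1 = 0%N by lia.
  by rewrite /= subr0 !add0r.
rewrite as_ ifT; last by lia.
rewrite ifT; last by lia.
by rewrite prednK -?as_// as_ bal -/t leqnn; ring.
Qed.

Let edge_index (e : {set SV}) : nat :=
  if [pick j : 'I_m | e == Sedge m d k j] is Some j then j else 0%N.

Let edge_indexK j : (j < m)%N -> edge_index (Sedge m d k j) = j.
Proof.
move=> jm; rewrite /edge_index; case: pickP => [i /eqP/Sedge_inj->//|].
by move/(_ (Ordinal jm)); rewrite eqxx.
Qed.

(* [path_value j] is the value on the edge [j] of the monomial of the positive eigenvector,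
   normalized at the edge 0. *)
Fixpoint path_value (j : nat) : R :=
  if j is i.+1 then path_value i * ((root_load i.+1 - alpha) / (last_load i - alpha)) else 1.

(** Pendant edges are normalized through [v_s], the last vertex of the edge [s - 1]. *)
Let edge_value j := if (j < d)%N then path_value j else
  path_value s.-1 * ((root_load j - alpha) / (last_load s.-1 - alpha)).

Lemma path_value_gt0 j : 0 < path_value j.
Proof. by elim: j => //= j IHj; rewrite mulr_gt0// divr_gt0// subr_gt0. Qed.

Let edge_value_gt0 j : 0 < edge_value j.
Proof.
rewrite /edge_value; case: ifP => _; first exact: path_value_gt0.
by rewrite mulr_gt0 ?path_value_gt0// divr_gt0// subr_gt0.
Qed.

(** The edge whose block contains [v]. Vertex 0 lies in no block; the truncated predecessor assigns
    it to the edge 0, of which it is the root. *)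
Let own_index (v : nat) := (v.-1 %/ q.+1)%N.
Let vertex_value v := edge_value (own_index v) / wt v (own_index v).

(** The root of an edge [j > 0] is the last vertex of the edge [root_index j - 1], and the ratio of
    the two edge values is the ratio of the weights there. *)
Lemma spider_value j (v : SV) : (j < m)%N -> v \in Sedge m d k j ->
  vertex_value v * wt v j = edge_value j.
Proof.
move=> jm; rewrite in_Sedge; case/orP => [/eqP vr|/andP[v0 /eqP vj]]; last first.
  by rewrite /vertex_value /own_index vj divfK// gt_eqF.
have [j0|jpos] := posnP j.
  have oj : own_index v = j.
    by rewrite /own_index vr SrootE j0 /root_index ifT ?mul0n ?div0n//; lia.
  by rewrite /vertex_value oj divfK// gt_eqF.
have /andP[a0 aj] := @root_index_le d d_gt1 j jpos.
have ad := @root_index_lt d d_gt1 j.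
have va : v = (root_index d j * q.+1)%N :> nat by rewrite vr SrootE.
have oj : own_index v = (root_index d j).-1.
  rewrite /own_index va; case: (root_index d j) a0 => // a _.
  by rewrite mulSn addSn /= addnC divnMDl// divn_small// addn0.
have w1 : wt v j = (root_load j - alpha) / (1 - alpha) by rewrite /wt /vertex_load vr eqxx.
have w2 : wt v (own_index v) = (last_load (root_index d j).-1 - alpha) / (1 - alpha).
  rewrite /wt /vertex_load oj ifF; last first.
    apply/negbTE/eqP => /(Sroot_notin_block d_gt1); rewrite -/(own_index v) oj eqxx andbT.
    by rewrite va muln_gt0 a0.
  by rewrite prednK// va eqxx.
rewrite /vertex_value w2 w1 oj.
have g0 : 1 - alpha != 0 by rewrite subr_eq0 gt_eqF.
have l0 : last_load (root_index d j).-1 - alpha != 0 by rewrite subr_eq0 gt_eqF.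
have -> : edge_value j = edge_value (root_index d j).-1 *
    ((root_load j - alpha) / (last_load (root_index d j).-1 - alpha)).
  rewrite /edge_value; have -> : ((root_index d j).-1 < d)%N by lia.
  rewrite /root_index; case: ifP => // jd; by case: j jpos {jm vr aj ad va oj w1 w2 l0 a0} jd.
by field; rewrite l0 g0.
Qed.

Lemma spider_weights : exists (B : SV -> {set SV} -> R) (X : SV -> R) (T : {set SV} -> R),
  [/\ forall e v, 0 < B v e,
      forall v, \sum_(e in SE m d k | v \in e) (alpha + (1 - alpha) * B v e) = L + alpha,
      forall e, e \in SE m d k -> \prod_(v in e) B v e = 1,
      forall v, 0 < X v &
      forall e v, e \in SE m d k -> v \in e -> X v * B v e = T e].
Proof.
exists (fun (v : SV) e => wt v (edge_index e)), (fun v : SV => vertex_value v),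
  (fun e => edge_value (edge_index e)); split.
- by [].
- move=> v; rewrite big_SE// -[RHS](spider_sum v); apply: eq_bigr => j _.
  rewrite edge_indexK// /wt mulrC divfK ?subrKC//.
  by rewrite subr_eq0 gt_eqF.
- move=> e /imsetP[j _ ->]; rewrite edge_indexK//; exact: spider_prod.
- by move=> v; rewrite divr_gt0.
- move=> e v /imsetP[j _ ->] vj; rewrite edge_indexK//; exact: spider_value.
Qed.

End SpiderWeights.

(** * Recognizing [S_{m,d,k}] *)

Section EdgePaths.
Variables (V : finType) (E : {set {set V}}).

Lemma is_path_edge_path v0 st : is_path E v0 st ->
  exists vv ee, edge_path E (size st) vv ee.
Proof.
case/and3P=> inc uv ue.
exists (nth v0 (v0 :: map snd st)), (nth set0 (map fst st)); split.
- elim: st v0 inc {uv ue} => [|[e v] st IHst] v0 //= /and4P[eE ve v1e inc] [|i] //= id.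
  have [h1 h2 h3] := IHst v inc i id; split=> //.
    rewrite (set_nth_default v)//=; by rewrite size_map ltnW.
  by rewrite (set_nth_default v)//= size_map.
- move=> i j /andP[ij jd]; rewrite nth_uniq ?ltn_eqF//= size_map ltnS//.
  exact: leq_trans (ltnW ij) jd.
- move=> i j /andP[ij jd]; rewrite nth_uniq ?ltn_eqF// size_map//.
  exact: ltn_trans jd.
Qed.

Variables (d : nat) (vv : nat -> V) (ee : nat -> {set V}).
Hypothesis vvee : edge_path E d vv ee.

(** Reversal exchanges the two middle vertices when [d] is odd, which reduces the second alternative
    of [tight_weights] to the first. *)
Lemma edge_path_rev : edge_path E d (fun i => vv (d - i)) (fun i => ee (d - i.+1)).
Proof.
have [inc vinj einj] := vvee; split=> [i id|i j ij|i j ij].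
- have [|h1 h2 h3] := inc (d - i.+1)%N; first by lia.
  by split=> //; rewrite (_ : d - i = (d - i.+1).+1)%N//; lia.
- by rewrite eq_sym; apply: vinj; lia.
- by rewrite eq_sym; apply: einj; lia.
Qed.

Lemma off_path_rev e :
  off_path d (fun i => ee (d - i.+1)) e = off_path d ee e.
Proof.
apply/off_pathP/off_pathP => h i id.
  by have := h (d - i.+1)%N; rewrite (_ : d - (d - i.+1).+1 = i)%N; [apply|]; lia.
by apply: h; lia.
Qed.

Lemma edge_path_le : (d <= #|E|)%N.
Proof.
have [inc _ einj] := vvee.
rewrite -[leqLHS]card_ord -(card_imset (f := fun i : 'I_d => ee i)).
  by apply/subset_leq_card/subsetP => _ /imsetP[i _ ->]; have [] := inc i.
move=> i j /eqP eij; apply/val_inj.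
case: (ltngtP i j) => // ij.
  by have := einj i j; rewrite ij ltn_ord eij => /(_ isT).
by have := einj j i; rewrite ij ltn_ord eq_sym eij => /(_ isT).
Qed.

End EdgePaths.

Section SpiderIso.
Variables (V : finType) (E : {set {set V}}) (q d : nat).
Hypotheses (conn : connected E) (acyclic : forall v0 st, ~~ is_cycle E v0 st).
Hypothesis Ek : uniform E q.+2.
Variables (vv : nat -> V) (ee : nat -> {set V}).
Hypotheses (d_gt1 : (1 < d)%N) (vvee : edge_path E d vv ee).
Hypothesis spider : forall e, e \in E -> off_path d ee e -> vv d./2 \in e.
Local Notation m := #|E|.
Local Notation k := q.+2.

Let dm : (d <= m)%N := edge_path_le vvee.

Let off_edges := [set e in E | off_path d ee e].
Let idx (e : {set V}) : nat :=
  if [pick i : 'I_d | ee i == e] is Some i then i else (d + index e (enum off_edges))%N.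

Let idx_ee i : (i < d)%N -> idx (ee i) = i.
Proof.
move=> id; rewrite /idx; case: pickP => [j /eqP e|/(_ (Ordinal id))]; last by rewrite eqxx.
have [_ _ einj] := vvee; case: (ltngtP j i) => // ij.
  by have := einj j i; rewrite ij id e eqxx => /(_ isT).
by have := einj i j; rewrite ij ltn_ord e eqxx => /(_ isT).
Qed.

Let idx_off e : off_path d ee e -> idx e = (d + index e (enum off_edges))%N.
Proof. by move=> offe; rewrite /idx; case: pickP => // i; rewrite off_path_neq. Qed.

Let idx_lt e : e \in E -> (idx e < m)%N.
Proof.
move=> eE; case: (path_or_off d ee e) => [[j jd ->]|offe].
  by rewrite idx_ee// (leq_trans jd).
rewrite idx_off//; have : (index e (enum off_edges) < #|off_edges|)%N.
  by rewrite cardE index_mem mem_enum inE eE.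
have -> : #|off_edges| = (m - d)%N.
  rewrite -(sum_off_path vvee) -big_mkcondr sum1_card.
  by apply: eq_card => f; rewrite inE.
by rewrite ltn_subRL.
Qed.

Let idx_inj e f : e \in E -> f \in E -> idx e = idx f -> e = f.
Proof.
move=> eE fE; case: (path_or_off d ee e) => [[i id ->]|offe];
  case: (path_or_off d ee f) => [[j jd ->]|offf].
- by rewrite !idx_ee// => ->.
- by rewrite idx_ee// idx_off// => h; move: id; rewrite h; lia.
- by rewrite idx_ee// idx_off// => h; move: jd; rewrite -h; lia.
rewrite !idx_off// => /addnI h.
rewrite -(nth_index set0 (s := enum off_edges) (x := e)) ?mem_enum ?inE ?eE// h.
by rewrite nth_index// mem_enum inE fE.
Qed.

Section Rooted.
Variables (r : {set V} -> V) (p : V -> {set V}) (rk : V -> nat).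
Hypothesis rt : rooted E E [set: V] (vv 0) r p rk.
Hypothesis rE : forall i, (i < d)%N -> r (ee i) = vv i.

Let path_child i : (i < d)%N -> vv i.+1 \in ee i :\ r (ee i).
Proof.
move=> id; have [inc vinj _] := vvee; have [_ _ h] := inc i id.
by rewrite !inE h rE// eq_sym vinj// ltnSn.
Qed.

Let child e u : e \in E -> u \in e :\ r e -> u != vv 0 /\ p u = e.
Proof. by move=> eE; rewrite !inE => /andP[ur ue]; apply: (rooted_child rt eE). Qed.

(** Otherwise [vv d./2] would be a child of [e], whereas its parent is a path edge. *)
Let root_off e : e \in E -> off_path d ee e -> r e = vv d./2.
Proof.
move=> eE offe; apply/eqP/negPn/negP => re.
have se : vv d./2 \in e :\ r e by rewrite !inE eq_sym re spider.
have [_ pe] := child eE se.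
have hd : ((d./2).-1 < d)%N by lia.
have [inc _ _] := vvee; have [fE _ _] := inc _ hd.
have := path_child hd; rewrite prednK; last by lia.
by move=> /(child fE)[_]; rewrite pe => h; move/off_pathP: offe => /(_ _ hd)/(_ h).
Qed.

Let enum_children (e : {set V}) : seq V := if (idx e < d)%N
  then rcons (enum (e :\ r e :\ vv (idx e).+1)) (vv (idx e).+1) else enum (e :\ r e).

Let last_child e : e \in E -> (idx e < d)%N -> vv (idx e).+1 \in e :\ r e.
Proof.
move=> eE; case: (path_or_off d ee e) => [[j jd ->]|offe]; last by rewrite idx_off//; lia.
by rewrite idx_ee// => _; exact: path_child.
Qed.

Let mem_children e : e \in E -> enum_children e =i e :\ r e.
Proof.
move=> eE u; rewrite /enum_children; case: ifP => h; last by rewrite mem_enum.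
rewrite mem_rcons in_cons mem_enum in_setD1; have := last_child eE h.
by case: eqP => [->|].
Qed.

Let uniq_children e : uniq (enum_children e).
Proof.
rewrite /enum_children; case: ifP => h; last exact: enum_uniq.
by rewrite rcons_uniq enum_uniq mem_enum setD11.
Qed.

Let size_children e : e \in E -> size (enum_children e) = q.+1.
Proof.
move=> eE; have <- : #|e :\ r e| = q.+1.
  by have := cardsD1 (r e) e; rewrite (rooted_root rt eE) (Ek eE) => -[].
rewrite -(eq_card (mem_children eE)); exact/esym/card_uniqP/uniq_children.
Qed.

(* The children of the path edge [j] are numbered with [vv j.+1] last, so that [vv j.+1] gets
   the number [j.+1 * q.+1] required by [Sroot]. *)
Let num (u : V) : nat := if u == vv 0 then 0%N
  else (idx (p u) * q.+1 + (index u (enum_children (p u))).+1)%N.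

Let num_child e u : e \in E -> u \in e :\ r e ->
  num u = (idx e * q.+1 + (index u (enum_children e)).+1)%N /\
  (index u (enum_children e) < q.+1)%N.
Proof.
move=> eE ue; have [uc pe] := child eE ue; rewrite /num (negPf uc) pe; split=> //.
by rewrite -(size_children eE) index_mem mem_children.
Qed.

Let parent u : u != vv 0 -> p u \in E /\ u \in p u :\ r (p u).
Proof.
by move=> uc; have [pE up ur] := rooted_parent rt (in_setT u) uc; rewrite !inE ur.
Qed.

Let num_block e u : e \in E -> u \in e :\ r e ->
  (0 < num u)%N /\ ((num u).-1 %/ q.+1)%N = idx e.
Proof.
move=> eE ue; have [-> iq] := num_child eE ue; rewrite addnS /=; split=> //.
by rewrite divnMDl// divn_small// addn0.
Qed.

Let num_path j : (j <= d)%N -> num (vv j) = (j * q.+1)%N.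
Proof.
case: j => [|j] jd; first by rewrite /num eqxx.
have [inc _ _] := vvee; have [fE _ _] := inc _ jd.
have [-> _] := num_child fE (path_child jd).
rewrite /enum_children idx_ee// jd -cats1 index_cat mem_enum setD11.
rewrite /= eqxx addn0 -cardE.
have := size_children fE; rewrite /enum_children idx_ee// jd size_rcons -cardE => ->.
by rewrite mulSn addnC.
Qed.

Let num_root e : e \in E -> num (r e) = Sroot d k (idx e).
Proof.
move=> eE; case: (path_or_off d ee e) => [[j jd ->]|offe].
  by rewrite rE// idx_ee// num_path ?(ltnW jd)// /Sroot jd.
by rewrite root_off// num_path ?idx_off// /Sroot ?ifF//; lia.
Qed.

(** For a nonzero number, the quotient of its predecessor by [q.+1] recovers the parent edge, and
    then the place among the children is determined. *)
Let num_inj : injective num.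
Proof.
move=> u v; have [->|uc] := eqVneq u (vv 0); have [->//|vc] := eqVneq v (vv 0).
- by have [pE vp] := parent vc; have [h _] := num_block pE vp; rewrite {1}/num eqxx => e; rewrite -e in h.
- by have [pE vp] := parent uc; have [h _] := num_block pE vp; rewrite {2}/num eqxx => e; rewrite e in h.
have [pE up] := parent uc; have [pE' vp] := parent vc => e.
have [_ b1] := num_block pE up; have [_ b2] := num_block pE' vp.
have pp : p u = p v by apply: idx_inj => //; rewrite -b1 -b2 e.
move: e; have [-> _] := num_child pE up; have [-> _] := num_child pE' vp.
rewrite pp => /addnI[h]; rewrite pp in up.
rewrite -(nth_index u (s := enum_children (p v)) (x := u)) ?mem_children// h.
by rewrite nth_index// mem_children.
Qed.

Let num_le u : (num u <= m * q.+1)%N.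
Proof.
have [->|uc] := eqVneq u (vv 0); first by rewrite /num eqxx.
have [pE up] := parent uc; have [-> h] := num_child pE up.
apply: (@leq_trans ((idx (p u)).+1 * q.+1)); last by rewrite leq_mul2r idx_lt ?orbT.
by rewrite mulSn addnC leq_add2r.
Qed.

Let f (u : V) : SV m k := inord (num u).
Let fE u : f u = num u :> nat. Proof. by rewrite /f inordK// ltnS num_le. Qed.
Let f_inj : injective f.
Proof. by move=> u v /(congr1 val); rewrite /= !fE => /num_inj. Qed.

Let card_V : #|V| = (m * q.+1).+1.
Proof.
have := sum_children rt (fun=> 1%N).
have -> : (\sum_(e in E) \sum_(v in e :\ r e) 1 = m * q.+1)%N.
  rewrite -sum_nat_const; apply: eq_bigr => e eE; rewrite sum1_card.
  by have := cardsD1 (r e) e; rewrite (rooted_root rt eE) (Ek eE) => -[].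
move=> ->; rewrite -sum1_card (bigD1 (vv 0))//=.
Qed.

(** The numbering sends each edge into the edge of S with the same index, and cardinalities agree.
    Conversely, an edge index [j] is reached through the parent of the vertex numbered last in block
    [j]. *)
Lemma rooted_spider_iso : hiso E (SE m d k).
Proof.
have bij_f : bijective f by apply: (inj_card_bij f_inj); rewrite card_V card_ord.
have img e : e \in E -> f @: e = Sedge m d k (idx e).
  move=> eE; apply/eqP; rewrite eqEcard card_Sedge ?idx_lt// card_imset ?Ek// leqnn andbT.
  apply/subsetP => _ /imsetP[u ue ->]; rewrite in_Sedge fE.
  have [->|ur] := eqVneq u (r e); first by rewrite num_root ?eqxx.
  have uc : u \in e :\ r e by rewrite !inE ur.
  by have [-> ->] := num_block eE uc; rewrite eqxx orbT.
exists f; split=> // e; apply/idP/imsetP => [eE|[j _ fe]].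
  by exists (Ordinal (idx_lt eE)); rewrite // img.
have [g _ gK] := bij_f; have := gK (block_vertex m j ord_max : SV m k).
set u := g _ => fu.
have nu : num u = (j * q.+1 + q.+1)%N by rewrite -fE fu block_vertexE.
have uc : u != vv 0 by apply/eqP => u0; move: nu; rewrite u0 /num eqxx addnS.
have [pE up] := parent uc; have [_ own] := num_block pE up.
have ij : idx (p u) = j.
  by rewrite -own nu addnS /= divnMDl// divn_small// addn0.
suff -> : e = p u by [].
by apply: (imset_inj f_inj); rewrite fe img// ij.
Qed.

End Rooted.

Lemma spider_iso : hiso E (SE m d k).
Proof.
have E0 e : e \in E -> e != set0 by move=> eE; rewrite -card_gt0 Ek.
(* The tree is rooted at the end [vv 0] rather than at the centre, because the numbering of S starts
   there. *)
have [r [p [rk [rt rE]]]] := path_rooting conn acyclic E0 (leq0n d) vvee.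
by apply: (rooted_spider_iso rt) => i /rE ->.
Qed.

End SpiderIso.

(** * Invariance under isomorphism and comparison of the spectral radii *)

Section Transport.
Variable C : numClosedFieldType.

Lemma hiso_sym (V1 V2 : finType) (E1 : {set {set V1}}) (E2 : {set {set V2}}) :
  hiso E1 E2 -> hiso E2 E1.
Proof.
move=> [f [[g fK gK] fE]]; exists g; split; first by exists f.
move=> e; rewrite fE -imset_comp (eq_imset (g := id)) ?imset_id//.
Qed.

Lemma hiso_eigenvalue (V1 V2 : finType) (E1 : {set {set V1}}) (E2 : {set {set V2}})
    k (alpha l : C) : hiso E1 E2 ->
  is_eigenvalue k (AalphaT E1 k alpha) l -> is_eigenvalue k (AalphaT E2 k alpha) l.
Proof.
move=> [f [[g fK gK] fE]] [x [[i xi] xl]].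
have f_inj := can_inj fK.
exists (x \o g); split; first by exists (f i); rewrite /= fK.
move=> j; rewrite -(gK j); set u := g j; rewrite /= fK -xl /tapp.
rewrite (reindex (fun t : (k.-1).-tuple V1 => map_tuple f t)) /=; last first.
  exists (fun t : (k.-1).-tuple V2 => map_tuple g t) => t _; apply/val_inj.
    by rewrite /= mapK.
  by rewrite /= mapK.
apply: eq_bigr => t _; rewrite big_map; congr (_ * _); last first.
  by apply: eq_bigr => v _; rewrite /= fK.
rewrite /AalphaT /adjT /degT -/(map f (u :: t)); congr (alpha * _ + _ * _); last first.
  rewrite (_ : [set y in map f (u :: t)] = f @: [set y in u :: t]) -?fE//.
  apply/setP => y; rewrite inE; apply/mapP/imsetP => -[z zt ->]; exists z => //.
    by rewrite inE.
  by rewrite inE in zt.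
rewrite all_map /= (eq_all (a2 := fun v => v == u)) => [|v]; last by rewrite /= (inj_eq f_inj).
have -> : degree E2 (f u) = degree E1 u.
  rewrite /degree -(card_imset _ (imset_inj f_inj)); apply: eq_card => e.
  apply/idP/imsetP => [|[e' + ->]].
    rewrite inE => /andP[eE fe].
    have ee : e = f @: (g @: e).
      rewrite -imset_comp -[LHS]imset_id; apply: eq_imset => y /=; by rewrite gK.
    exists (g @: e) => //; rewrite inE fE -ee eE /=.
    by rewrite -(fK u) imset_f.
  by rewrite !inE -fE mem_imset.
by [].
Qed.

End Transport.

Lemma eigenvalue_spider (C : numClosedFieldType) (q m d : nat) (alpha L : realPart C) :
  (1 < d)%N -> (d <= m)%N -> 0 <= alpha -> alpha < 1 ->
  admissible q alpha ((1 - alpha) ^+ q.+2) L (d - d./2)%N ->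
  (let w := level q alpha ((1 - alpha) ^+ q.+2) L in
   L + alpha = w d./2 + w (d - d./2)%N + (m - d)%N%:R * w 1%N) ->
  is_eigenvalue q.+2 (AalphaT (SE m d q.+2) q.+2 (realVal alpha)) (realVal (L + alpha)).
Proof.
move=> d1 dm a0 a1 adm bal.
have [B [X [T [B0 BS B1 X0 XT]]]] := spider_weights d1 dm a0 a1 adm bal.
apply: (@weight_eigenvalue C _ _ q.+2 isT (uniform_SE d1 dm) (realVal alpha)
  (realVal (L + alpha)) (fun v e => realVal (B v e)) _ (fun v => realVal (X v))
  (fun e => realVal (T e))).
- by move=> e v _ _; apply: B0.
- move=> v; rewrite -(BS v) rmorph_sum /=; apply: eq_bigr => e _.
  by [].
- by move=> e eE; rewrite -rmorph_prod B1.
- exact: X0.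
- by move=> e v eE ve; rewrite -rmorphM XT.
- exact: ord0.
Qed.

Lemma eigenvalue_hypertree (C : numClosedFieldType) (V : finType) (E : {set {set V}})
    (q d : nat) (alpha L : realPart C) (vv : nat -> V) (ee : nat -> {set V}) (l : C) :
  uniform E q.+2 -> hypertree E -> (1 < d)%N -> edge_path E d vv ee ->
  0 <= alpha -> alpha < 1 ->
  admissible q alpha ((1 - alpha) ^+ q.+2) L (d - d./2)%N ->
  (let w := level q alpha ((1 - alpha) ^+ q.+2) L in
   L + alpha = w d./2 + w (d - d./2)%N + (#|E| - d)%N%:R * w 1%N) ->
  is_eigenvalue q.+2 (AalphaT E q.+2 (realVal alpha)) l ->
  `|l| <= realVal (L + alpha) /\
  (`|l| = realVal (L + alpha) -> hiso E (SE #|E| d q.+2)).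
Proof.
move=> Ek [conn acyc] d1 vvee a0 a1 adm bal eig.
have s0 : (0 < d./2)%N by lia.
have sd : (d./2 <= d - d./2 <= d./2.+1)%N by lia.
have [B [B0 BS B1 tight]] := tree_weights conn acyc Ek s0 sd vvee a0 a1 adm bal.
have [||| lam eqlam] := @eigenvalue_le_weight C V E q.+2 isT Ek (realVal alpha)
  (realVal (L + alpha)) (fun v e => realVal (B v e)) a0 a1 _ _ _ l eig.
- by move=> e v eE ve; apply: B0.
- move=> v; rewrite -(BS v) rmorph_sum /=; apply: eq_bigr => e _.
  by [].
- by move=> e eE; rewrite -rmorph_prod; apply: B1.
split=> // /(eqlam conn) B_eq1.
have [|sp|sp] := tight.
- by move=> e eE; apply: val_inj; rewrite /= rmorph_prod B_eq1.
- exact: (spider_iso conn acyc Ek d1 vvee).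
apply: (spider_iso conn acyc Ek d1 (edge_path_rev vvee)) => e eE.
by rewrite off_path_rev; apply: sp.
Qed.

Unset Implicit Arguments.

Theorem theorem5p3 (C : numClosedFieldType) (k : nat) (alpha : C)
  (V : finType) (E : {set {set V}}) (m d : nat) :
  (2 <= k)%N -> 0 <= alpha -> alpha < 1 ->
  uniform E k -> hypertree E -> #|E| = m ->
  diameter_eq E d -> (2 <= d)%N ->
  forall rG rS : C,
    is_spectral_radius k (AalphaT E k alpha) rG ->
    is_spectral_radius k (AalphaT (SE m d k) k alpha) rS ->
    rG <= rS /\ (rG = rS <-> hiso E (SE m d k)).
Proof.
case: k => [|[|q]] // _ a0 a1 Ek tree <- [[u [v [[st /and3P[pst _ /eqP sz]] _]]] _] d1.
move=> rG rS [[lG [eigG nG]] maxG] [[lS [eigS nS]] maxS].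
have [vv [ee]] := is_path_edge_path pst; rewrite {}sz => vvee.
pose a : realPart C := RealPart (ger0_real a0).
have a0' : 0 <= a by exact: a0.
have a1' : a < 1 by exact: a1.
have c0 : 0 < (1 - a) ^+ q.+2 by rewrite exprn_gt0// subr_gt0.
have st' : (0 < d./2 <= d - d./2)%N by lia.
(* The equation for [L] involves only [d] and the number of edges, so one [L] serves both
   hypertrees: [L + a] bounds the eigenvalues of [E] and is itself an eigenvalue of S. *)
have [L adm bal] := level_balance q a0' c0 (#|E| - d) st'.
have eigL := eigenvalue_spider d1 (edge_path_le vvee) a0' a1' adm bal.
have leG l := @eigenvalue_hypertree C V E q d a L vv ee l Ek tree d1 vvee a0' a1' adm bal.
have LrS : realVal (L + a) <= rS.
  by apply: le_trans (maxS _ eigL); apply: real_ler_norm (realValP _).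
have [rGL eqL] := leG lG eigG; rewrite nG in rGL eqL.
split; first exact: le_trans LrS.
split=> [eqr|iso].
  by apply: eqL; apply/eqP; rewrite eq_le rGL eqr LrS.
apply/eqP; rewrite eq_le (le_trans rGL LrS) -nS.
exact: maxG (hiso_eigenvalue (hiso_sym iso) eigS).
Qed.
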